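(* For every $u\in\mathbb{Q}\langle\mathcal{B}\rangle$, $$Z^{\mathrm{SZ}}_{q}\!\left(\operatorname{reg}_{*}(u)\right)=\operatorname*{Res}_{z=1}\frac{L^{\mathrm{SZ}}_{q}(u)(z)}{z(z-1)}\,dz.$$
   Context: $q$ is a fixed complex number with $0<|q|<1$; $\mathcal{M}(\mathbb{C})$ is the field of meromorphic functions of $z$ on $\mathbb{C}$. $\mathbb{Q}\langle\mathcal{B}\rangle$ is the free noncommutative $\mathbb{Q}$-algebra on $\mathcal{B}=\{b_0,b_1,b_2,\dots\}$ with empty word $1$; $\mathbb{Q}\langle\mathcal{B}\rangle^{0}$ is the subspace spanned by $1$ and all words not ending with $b_0$. The $\mathbb{Q}$-linear map $Z^{\mathrm{SZ}}_q\colon\mathbb{Q}\langle\mathcal{B}\rangle^0\to\mathbb{C}$ is $$Z^{\mathrm{SZ}}_q(b_{k_1}\cdots b_{k_d})=\sum_{0<m_1<\cdots<m_d}\prod_{j=1}^d\left(\frac{q^{m_j}}{1-q^{m_j}}\right)^{k_j},\qquad Z^{\mathrm{SZ}}_q(1)=1.$$ The stuffle product $*$ on $\mathbb{Q}\langle\mathcal{B}\rangle$ is the $\mathbb{Q}$-bilinear map with $1*u=u*1=u$ and $(b_iu)*(b_jv)=b_i(u*b_jv)+b_j(b_iu*v)+b_{i+j}(u*v)$ for words $u,v$ and $i,j\ge0$. Every $u\in\mathbb{Q}\langle\mathcal{B}\rangle$ is uniquely $u=u_0+u_1*b_0+\cdots+u_k*b_0^{*k}$ with $u_j\in\mathbb{Q}\langle\mathcal{B}\rangle^{0}$;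 put $\operatorname{reg}_*(u)=u_0$. The $\mathbb{Q}$-linear map $L^{\mathrm{SZ}}_q\colon\mathbb{Q}\langle\mathcal{B}\rangle\to\mathcal{M}(\mathbb{C})$ sends $1$ to $1$ and $b_{k_1}\cdots b_{k_d}$ ($k_i\ge0$) to the meromorphic continuation to $\mathbb{C}$ (with possible poles only at $z\in q^{\mathbb{Z}_{\le0}}$) of the function $$\sum_{0<m_1<\cdots<m_d}z^{m_d}\prod_{j=1}^d\left(\frac{q^{m_j}}{1-q^{m_j}}\right)^{k_j},$$ whose defining series converges absolutely for $|z|<|q|^{-k_d}$. *)

(* Defs.v *)
From mathcomp Require Import all_boot all_order all_algebra.
From mathcomp Require Import finmap complex.
From mathcomp Require Import boolp classical_sets reals topology normedtype.
From mathcomp Require Import sequences.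
From mathcomp Require summability.
(* The notations of monalg are incompatible with those of MathComp-Analysis. *)
From mathcomp Require Import -(notations) monalg.

Set Implicit Arguments.
Unset Strict Implicit.
Unset Printing Implicit Defensive.

Import Order.TTheory GRing.Theory Num.Theory.
Import numFieldNormedType.Exports.

Local Open Scope classical_set_scope.
Local Open Scope ring_scope.

(* The monoid algebra, over rat, of the free monoid on nat; the letter b_i is
   represented by i : nat, and the ring product of QB is concatenation. *)
Notation QB := (malg (fmonom nat) rat).

Definition word (w : seq nat) : QB := mkmalgU (FMonom w) 1.
Definition letter (i : nat) : QB := word [:: i].

(* The default value 1 of last makes the empty word admissible. *)
Definition QB0 : set QB :=
  [set u : QB | forall w : fmonom nat, w \in msupp u -> last 1%N w != 0%N].

Fixpoint stuffle_word (u : seq nat) : seq nat -> QB :=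
  if u is i :: u' then
    fix stuffle_u (v : seq nat) : QB :=
      if v is j :: v' then
        letter i * stuffle_word u' v + letter j * stuffle_u v'
          + letter (i + j)%N * stuffle_word u' v'
      else word u
  else word.

Definition stuffle (x y : QB) : QB :=
  \sum_(u <- msupp x) \sum_(v <- msupp y)
    (mcoeff u x * mcoeff v y) *: stuffle_word u v.

Definition stuffle_exp (x : QB) (n : nat) : QB := iter n (stuffle x) 1.

Definition reg_decomposition (u : QB) (k : nat) (v : nat -> QB) : Prop :=
  (forall j, (j <= k)%N -> QB0 (v j)) /\
  u = \sum_(j < k.+1) stuffle (v j) (stuffle_exp (letter 0) j).

Definition reg (u : QB) : QB :=
  xget 0 [set u0 | exists k v, reg_decomposition u k v /\ u0 = v 0%N].

Section Complex.
Variable R : realType.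
Local Notation C := (R[i]^o).

(* (z - c)^N f(z) is the sum of the power series a in z - c, for all z <> c
   near c; equivalently f has at c the Laurent expansion
   \sum_n a_n (z - c)^(n - N). *)
Definition laurent_at (f : C -> C) (c : C) (N : nat) (a : nat -> C) : Prop :=
  \forall z \near c^',
    series (fun n => a n * (z - c) ^+ n) @ \oo --> (z - c) ^+ N * f z.

(* Meromorphic functions are represented by total functions, whose values at
   the poles are irrelevant. *)
Definition meromorphic (f : C -> C) : Prop :=
  forall c : C, exists N a, laurent_at f c N a.

(* f has no pole at c: its Laurent expansion at c has no principal part, and
   also represents f at c itself. *)
Definition regular_at (f : C -> C) (c : C) : Prop :=
  exists a : nat -> C,
    \forall z \near c, series (fun n => a n * (z - c) ^+ n) @ \oo --> f z.

(* The coefficient of (z - c)^-1 in the Laurent expansion of f at c. A bound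
   N.+1 on the order of the pole is no restriction, since N can be enlarged. *)
Definition residue (f : C -> C) (c : C) : C :=
  xget 0 [set r | exists N a, laurent_at f c N.+1 a /\ r = a N].

(* The tuples m of naturals with 0 < m_1 < ... < m_d. *)
Notation SZ_index d := {m : d.-tuple nat | path ltn 0%N m}.

Definition SZ_term (q : C) (k m : seq nat) : C :=
  \prod_(j < size k)
    (q ^+ nth 0%N m j / (1 - q ^+ nth 0%N m j)) ^+ nth 0%N k j.

(* summability.sum is the unconditional sum, that is, the limit of the finite
   partial sums along the finite subsets of the index type. It converges when
   the word k does not end with b_0; for k = [::] it is 1. *)
Definition ZSZ_word (q : C) (k : seq nat) : C :=
  summability.sum
    (fun m : SZ_index (size k) => SZ_term q k (val m) : C).

Definition ZSZ (q : C) (u : QB) : C :=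
  \sum_(w <- msupp u) ratr (mcoeff w u) * ZSZ_word q w.

Definition LSZ_series (q : C) (k : seq nat) (z : C) : C :=
  summability.sum
    (fun m : SZ_index (size k) =>
       z ^+ last 0%N (val m) * SZ_term q k (val m) : C).

Definition LSZ_continuation (q : C) (k : seq nat) (F : C -> C) : Prop :=
  [/\ meromorphic F,
      forall c : C, ~ (exists n : nat, c = q ^- n) -> regular_at F c &
      forall z : C, `|z| < `|q| ^- last 0%N k -> F z = LSZ_series q k z].

(* For every nonempty word the continuation is unique up to its values at the
   poles. *)
Definition LSZ_word (q : C) (k : seq nat) : C -> C :=
  if k is [::] then fun=> 1 else xget (fun=> 0) (LSZ_continuation q k).

Definition LSZ (q : C) (u : QB) (z : C) : C :=
  \sum_(w <- msupp u) ratr (mcoeff w u) * LSZ_word q w z.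

End Complex.

(* Main.v *)
Require Import Defs.
From mathcomp Require Import all_boot all_order all_algebra.
From mathcomp Require Import finmap complex.
From mathcomp Require Import boolp classical_sets reals topology normedtype.
From mathcomp Require Import sequences.
From mathcomp Require summability.
From mathcomp Require Import -(notations) monalg.
From mathcomp Require Import ring lra.

Set Implicit Arguments.
Unset Strict Implicit.
Unset Printing Implicit Defensive.

Import Order.TTheory GRing.Theory Num.Theory.
Import numFieldNormedType.Exports.

Local Open Scope classical_set_scope.
Local Open Scope ring_scope.

(** For a word [w = b_(k_1) ... b_(k_d)] let [alpha w M] be the sum of
    [\prod_j x_(m_j) ^ k_j], with [x_m = q ^ m / (1 - q ^ m)], over
    [0 < m_1 < ... < m_d = M], so that [L(w)(z)] is the sum of the power series
    [\sum_M alpha w M * z ^ M] near [0]. Write a word as [v b_0 ^ p] with [v] empty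
    or not ending with [b_0]. Appending [b_0] multiplies the generating series by
    [z / (1 - z)] ([psum_rcons0]), hence
    [[
      L(v b_0 ^ p)(z) / (z (z - 1))
        = (-1) ^ p (z - 1) ^ (- p - 1) \sum_m alpha v m * z ^ (m + p - 1),
    ]]
    where the series converges in a disc of radius greater than [1] (for [v] empty
    and [p = 0] it is just [1 / z]). Expanding it at [1] gives the residue
    [(-1) ^ p \sum_m alpha v m * 'C(m + p - 1, p)]
    ([residue_word]). For [p = 0] this is [Z(v)], so that the residue and [Z] agree
    on [QB0] ([residueQ_QB0]).

    It remains to see that the residue vanishes on every stuffle multiple of [b_0]
    ([residueQ_stuffle0]), since [u - reg u] is a sum of such multiples. Stuffle
    multiplication [D] by [b_0] satisfies [D(w b_a) = D(w) b_a + w b_a b_0 + w b_a]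
    for concatenation ([stuffle0_rcons]), and it multiplies the truncated sums
    [\sum_(i < N) alpha w i] by [N - 1] ([sum_alphaQ_stuffle0]). For [v] ending with
    [b_a], the residue of [D(v b_0 ^ p)] is therefore a series whose terms vanish
    by [(m + p) 'C(m + p - 1, p) = (p + 1) 'C(m + p, p + 1)].

    Three further ingredients are needed. The decomposition defining [reg] exists
    ([regP]): the relation [D(w b_a) = ...] expresses [v b_0 ^ (p + 1)] through
    [D(v b_0 ^ p)] and words with fewer trailing [b_0]. The meromorphic
    continuation exists ([LSZ_continuation_exists]): it is given by the factor
    [z / (1 - z)] for a last letter [b_0], and otherwise by iterating
    [L(w b_(k + 1))(z) = L(w b_(k + 1))(q z) + L(w b_k)(q z)] ([psum_rconsS]).
    Finally, a function meromorphic at [1] is determined near [1] by its values on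
    the left of [1] ([mero_at_left_eq]), which makes the chosen continuation
    irrelevant. All the facts on complex power series are deduced from dominated
    convergence for series ([tannery]). *)

(** * The modulus of a complex number *)

Section Modulus.
Variable R : realType.
Local Notation C := (R[i]^o).
Implicit Types z w : C.

(** The norm of [R[i]] takes its values in [R[i]]; [modulus] is the same norm with
    values in the ordered field [R]. *)
Definition modulus z : R := complex.Re `|z|.

Lemma modulusE z : `|z| = (modulus z)%:C%C.
Proof. by rewrite /modulus RRe_real // normr_real. Qed.

Lemma modulus_ge0 z : 0 <= modulus z.
Proof. by have := normr_ge0 z; rewrite modulusE ler0c. Qed.

Lemma modulus_eq0 z : (modulus z == 0) = (z == 0).
Proof.
apply/eqP/eqP => [z0|->]; last by rewrite /modulus normr0.
by apply/eqP; rewrite -normr_eq0 modulusE z0.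
Qed.

Lemma modulus0 : modulus 0 = 0.
Proof. by apply/eqP; rewrite modulus_eq0. Qed.

Lemma modulus_gt0 z : (0 < modulus z) = (z != 0).
Proof. by rewrite lt_neqAle modulus_ge0 eq_sym modulus_eq0 andbT. Qed.

Lemma modulus1 : modulus 1 = 1.
Proof. by apply: complexI; rewrite -modulusE normr1. Qed.

Lemma modulusM z w : modulus (z * w) = modulus z * modulus w.
Proof. by apply: complexI; rewrite -modulusE normrM !modulusE rmorphM. Qed.

Lemma modulusV z : modulus z^-1 = (modulus z)^-1.
Proof. by apply: complexI; rewrite -modulusE normfV !modulusE fmorphV. Qed.

Lemma modulusX z n : modulus (z ^+ n) = modulus z ^+ n.
Proof. by apply: complexI; rewrite -modulusE normrX !modulusE rmorphXn. Qed.

Lemma modulusN z : modulus (- z) = modulus z.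
Proof. by apply: complexI; rewrite -modulusE normrN modulusE. Qed.

Lemma modulus_distC z w : modulus (z - w) = modulus (w - z).
Proof. by rewrite -modulusN opprB. Qed.

Lemma modulus_nat n : modulus n%:R = n%:R.
Proof. by apply: complexI; rewrite -modulusE normr_nat rmorph_nat. Qed.

Lemma modulus_real (r : R) : modulus (r%:C%C : C) = `|r|.
Proof.
by rewrite /modulus normc_def /= expr0n addr0 sqrtr_sqr.
Qed.

Lemma modulusD z w : modulus (z + w) <= modulus z + modulus w.
Proof. by rewrite -lecR rmorphD -!modulusE ler_normD. Qed.

Lemma modulusB z w : modulus (z - w) <= modulus z + modulus w.
Proof. by rewrite -(modulusN w) modulusD. Qed.

Lemma modulus_sum I (r : seq I) (P : pred I) (F : I -> C) :
  modulus (\sum_(i <- r | P i) F i) <= \sum_(i <- r | P i) modulus (F i).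
Proof.
elim/big_rec2 : _ => [|i x y _ xy]; first by rewrite modulus0.
by rewrite (le_trans (modulusD _ _))// lerD2l.
Qed.

Lemma modulus_Re z : `|complex.Re z| <= modulus z.
Proof. by rewrite -lecR -modulusE normc_ge_Re. Qed.

Lemma modulus_Im z : `|complex.Im z| <= modulus z.
Proof.
rewrite -(modulusN z) -normrN; have := modulus_Re (z * 'i%C).
by rewrite ReiNIm modulusM /(modulus 'i%C) normc_def /= expr0n add0r expr1n
  sqrtr1 mulr1 modulusN.
Qed.

Lemma modulus_le_ReIm z : modulus z <= `|complex.Re z| + `|complex.Im z|.
Proof.
rewrite /modulus normc_def /= -[leRHS]ger0_norm ?addr_ge0// -sqrtr_sqr.
rewrite ler_sqrt ?sqr_ge0// sqrrD !real_normK ?num_real//.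
by rewrite lerD2r lerDl mulrn_wge0// mulr_ge0.
Qed.

Lemma ltc_modulus z (e : C) : 0 < e -> (`|z| < e) = (modulus z < complex.Re e).
Proof. by case: e => a b; rewrite ltcE /= => /andP[/eqP -> _]; rewrite modulusE ltcR. Qed.

Lemma cvg_modulusP (u : nat -> C) (l : C) :
  u @ \oo --> l <->
  forall e : R, 0 < e -> exists N, forall n, (N <= n)%N -> modulus (u n - l) < e.
Proof.
split=> [/cvgrPdist_lt ul e e0|ul].
  have /ul : 0 < (e%:C%C : C) by rewrite ltcR.
  case=> N _ Ne; exists N => n /Ne /=.
  by rewrite ltc_modulus ?ltcR// modulus_distC.
apply/cvgrPdist_lt => e e0.
have re0 : 0 < complex.Re e by move: e0; rewrite ltcE /= => /andP[].
have [N Ne] := ul _ re0; exists N => // n /= Nn.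
by rewrite ltc_modulus// modulus_distC; exact: Ne.
Qed.

Lemma nearcP (c : C) (P : C -> Prop) :
  (\forall z \near c, P z) <->
  exists r : R, 0 < r /\ forall h, modulus h < r -> P (c + h).
Proof.
split=> [/nbhs_ballP[e /= e0 eP]|[r [r0 rP]]].
  have re0 : 0 < complex.Re e by move: e0; rewrite ltcE /= => /andP[].
  exists (complex.Re e); split=> // h he; apply: eP.
  by rewrite -ball_normE /= opprD addrA subrr add0r normrN ltc_modulus.
apply/nbhs_ballP; exists (r%:C%C); rewrite /= ?ltcR// => z.
rewrite -ball_normE /= ltc_modulus ?ltcR// modulus_distC => /rP.
by rewrite addrC subrK.
Qed.

Lemma nearc_dnbhsP (c : C) (P : C -> Prop) :
  (\forall z \near c^', P z) <->
  exists r : R, 0 < r /\ forall h, h != 0 -> modulus h < r -> P (c + h).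
Proof.
rewrite /dnbhs /within /=; split=> [/nearcP[r [r0 rP]]|[r [r0 rP]]].
  exists r; split=> // h h0 hr; apply: rP => //.
  by rewrite -subr_eq0 addrC addKr.
apply/nearcP; exists r; split=> // h hr hc; apply: rP => //.
by move: hc; rewrite -subr_eq0 addrC addKr.
Qed.

Lemma cvg_modulus_le (u : nat -> C) (l : C) (B : R) :
  u @ \oo --> l -> (forall n, modulus (u n) <= B) -> modulus l <= B.
Proof.
move=> /cvg_modulusP ul uB; apply/ler_addgt0Pr => e e0.
have [N /(_ _ (leqnn N))Ne] := ul _ e0.
have -> : l = u N - (u N - l) by rewrite opprB addrC subrK.
by rewrite (le_trans (modulusB _ _))// lerD// ltW.
Qed.

End Modulus.

(** * Absolutely convergent complex series *)

Section AbsoluteSeries.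
Variable R : realType.
Local Notation C := (R[i]^o).

Lemma series_tail (M : nat -> R) (e : R) :
    (forall n, 0 <= M n) -> cvgn (series M) -> 0 < e ->
  exists J, forall n, \sum_(J <= i < J + n) M i < e.
Proof.
move=> M0 Mc e0.
have /cvgrPdist_lt/(_ _ e0)[J _ Je] := Mc.
exists J => n; have := Je J (leqnn J); rewrite /=.
have nd : nondecreasing_seq (series M).
  by apply/nondecreasing_seqP => k; rewrite seriesSr lerDl.
have h1 := nondecreasing_cvgn_le nd Mc J.
rewrite ger0_norm ?subr_ge0//; apply: le_lt_trans.
by rewrite -sub_series_geq ?leq_addr// lerD2r; exact: nondecreasing_cvgn_le.
Qed.

(** Absolute convergence implies convergence, through real and imaginary parts. *)
Lemma series_dom_cvg (a : nat -> C) (M : nat -> R) :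
  (forall n, modulus (a n) <= M n) -> cvgn (series M) -> cvgn (series a).
Proof.
move=> aM Mc.
have reim (f : C -> R) : (forall z, `|f z| <= modulus z) ->
    {morph f : x y / x + y} -> f 0 = 0 ->
    exists l : R, series (fun n => f (a n)) @ \oo --> l.
  move=> fm fD f0; exists (limn (series (fun n => f (a n)))).
  apply: normed_cvg; apply: series_le_cvg Mc => n /=; first exact: normr_ge0.
    exact: le_trans (modulus_ge0 _) (aM n).
  exact: le_trans (fm _) (aM n).
(* [Rcomplex R] is [R[i]] as a vector space over [R]. *)
pose ReR := (@complex.Re R : Rcomplex R -> R).
pose ImR := (@complex.Im R : Rcomplex R -> R).
have [x ax] := reim (@complex.Re R) (@modulus_Re R) (fun x y => raddfD ReR x y) erefl.
have [y ay] := reim (@complex.Im R) (@modulus_Im R) (fun x y => raddfD ImR x y) erefl.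
apply/cvg_ex; exists (Complex x y); apply/cvg_modulusP => e e0.
have e20 : 0 < e / 2 by rewrite divr_gt0.
have /cvgrPdist_lt/(_ _ e20)[N1 _ h1] := ax.
have /cvgrPdist_lt/(_ _ e20)[N2 _ h2] := ay.
exists (maxn N1 N2) => n; rewrite geq_max => /andP[/h1 /= {}h1 /h2 /= {}h2].
apply: le_lt_trans (modulus_le_ReIm _) _.
have ReE : complex.Re (series a n) = series (fun n => complex.Re (a n)) n.
  by rewrite /series /= (raddf_sum ReR).
have ImE : complex.Im (series a n) = series (fun n => complex.Im (a n)) n.
  by rewrite /series /= (raddf_sum ImR).
rewrite (raddfB ReR) (raddfB ImR) /=.
rewrite ReE ImE [e]splitr; apply: ltrD; by rewrite distrC.
Qed.

Lemma series_dom_tail (a : nat -> C) (l : C) (M : nat -> R) J (e : R) :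
    (forall n, modulus (a n) <= M n) ->
    (forall n, \sum_(J <= i < J + n) M i < e) ->
    series a @ \oo --> l ->
  modulus (l - series a J) <= e.
Proof.
move=> aM Me al.
have : (fun n => series a (n + J)%N - series a J) @ \oo --> l - series a J.
  apply: cvgB; last exact: cvg_cst.
  by rewrite -(cvg_shiftn J) in al.
move=> /cvg_modulus_le; apply => n.
rewrite addnC sub_series_geq ?leq_addr//.
apply: le_trans (modulus_sum _ _ _) _; apply: le_trans (ltW (Me n)).
exact: ler_sum.
Qed.

Lemma cvg_addC (u v : nat -> C) (U V : C) :
    u @ \oo --> U -> v @ \oo --> V ->
  (fun n => u n + v n) @ \oo --> U + V.
Proof. exact: (@cvgD R[i] C nat \oo). Qed.

Lemma series_cvg_pointwise (f : nat -> nat -> C) (g : nat -> C) J :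
    (forall j, (fun N => f N j) @ \oo --> g j) ->
  (fun N => series (f N) J) @ \oo --> series g J.
Proof.
move=> fg; elim: J => [|J IH].
  rewrite /series /= big_geq// (_ : (fun _ => _) = fun=> 0); first exact: cvg_cst.
  by apply/funext => N; rewrite big_geq.
rewrite seriesSr (_ : (fun _ => _) = (fun N => series (f N) J + f N J)).
  exact: (cvg_addC IH (fg J)).
by apply/funext => N; rewrite seriesSr.
Qed.

(** Dominated convergence for series (Tannery's theorem). *)
Lemma tannery (f : nat -> nat -> C) (g : nat -> C) (M : nat -> R)
    (S : nat -> C) (T : C) :
    (forall N j, modulus (f N j) <= M j) -> cvgn (series M) ->
    (forall j, (fun N => f N j) @ \oo --> g j) ->
    (forall N, series (f N) @ \oo --> S N) -> series g @ \oo --> T ->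
  S @ \oo --> T.
Proof.
move=> fM Mc fg fS gT.
have gM j : modulus (g j) <= M j by exact: cvg_modulus_le (fg j) (fM ^~ j).
have M0 j : 0 <= M j by exact: le_trans (modulus_ge0 _) (gM j).
apply/cvg_modulusP => e e0.
(* Cut the series at [J]: both tails and the difference of the partial sums
   are bounded by [e / 3]. *)
have e30 : 0 < e / 3 by rewrite divr_gt0.
have [J Je] := series_tail M0 Mc e30.
have /cvg_modulusP/(_ _ e30)[N Ne] :
    (fun n => series (f n) J) @ \oo --> series g J.
  exact: series_cvg_pointwise.
exists N => n /Ne h.
have h1 := series_dom_tail (fM n) Je (fS n).
have h2 := series_dom_tail gM Je gT.
have -> : S n - T = (S n - series (f n) J) + (series (f n) J - series g J)
   - (T - series g J) by ring.
apply: le_lt_trans (modulusB _ _) _.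
apply: le_lt_trans (lerD (modulusD _ _) (lexx _)) _.
lra.
Qed.

Lemma cvg_mulC (u v : nat -> C) (U V : C) :
    u @ \oo --> U -> v @ \oo --> V ->
  (fun n => u n * v n) @ \oo --> U * V.
Proof.
move=> /cvg_modulusP uU /cvg_modulusP vV; apply/cvg_modulusP => e e0.
have B0 : 0 < 1 + modulus U + modulus V by rewrite -addrA ltr_pwDl// addr_ge0 ?modulus_ge0.
pose d := Num.min 1 (e / (1 + modulus U + modulus V)).
have d0 : 0 < d by rewrite lt_min ltr01 divr_gt0.
have [N1 h1] := uU _ d0; have [N2 h2] := vV _ d0.
exists (maxn N1 N2) => n; rewrite geq_max => /andP[/h1 {}h1 /h2 {}h2].
have -> : u n * v n - U * V = (u n - U) * (v n - V) + U * (v n - V) + (u n - U) * V by ring.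
have de : d * (1 + modulus U + modulus V) <= e by rewrite -ler_pdivlMr// ge_min lexx orbT.
have d1 : d <= 1 by rewrite ge_min lexx.
apply: lt_le_trans de; apply: le_lt_trans (modulusD _ _) _.
apply: le_lt_trans (lerD (modulusD _ _) (lexx _)) _; rewrite !modulusM.
rewrite !mulrDr mulr1; apply: ltr_leD; first apply: ltr_leD.
- apply: le_lt_trans h1; rewrite -[leRHS]mulr1 ler_wpM2l ?modulus_ge0//.
  exact: ltW (lt_le_trans h2 d1).
- by rewrite mulrC ler_wpM2r ?modulus_ge0// ltW.
- by rewrite ler_wpM2r ?modulus_ge0// ltW.
Qed.

Lemma cvg_mulCl (c : C) (u : nat -> C) (U : C) :
  u @ \oo --> U -> (fun n => c * u n) @ \oo --> c * U.
Proof.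
move=> uU; have h : (fun _ : nat => c) @ \oo --> c by exact: cvg_cst.
exact: (@cvg_mulC (fun=> c) u c U h uU).
Qed.

Lemma cvg_geometric_bound (K s : R) : 0 <= s < 1 ->
  cvgn (series (fun n => K * s ^+ n)).
Proof.
by move=> /andP[s0 s1]; apply: (@is_cvg_geometric_series R); rewrite ger0_norm.
Qed.

End AbsoluteSeries.
Arguments cvg_mulCl {R} c {u U}.

(** * Power series and their sums *)

Section PowerSeries.
Variable R : realType.
Local Notation C := (R[i]^o).

Lemma cvg_eventually_cst (u : nat -> C) (l : C) N :
  (forall n, (N <= n)%N -> u n = l) -> u @ \oo --> l.
Proof.
move=> uN; apply/cvg_modulusP => e e0; exists N => n /uN ->.
by rewrite subrr modulus0.
Qed.

Lemma eq_cvg_series (u v : nat -> C) (l : C) : u =1 v ->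
  series u @ \oo --> l -> series v @ \oo --> l.
Proof. by move=> /funext ->. Qed.

Lemma series_eq0 (u : nat -> C) N n :
  (forall i, (N <= i)%N -> u i = 0) -> (N <= n)%N -> series u n = series u N.
Proof.
move=> u0 Nn; apply/eqP; rewrite -subr_eq0 sub_series_geq//.
by rewrite big_nat big1// => i /andP[/u0].
Qed.

Lemma cvg_seriesMl (c : C) (u : nat -> C) (U : C) :
  series u @ \oo --> U -> series (fun i => c * u i) @ \oo --> c * U.
Proof.
move=> uU; rewrite (_ : series _ = fun n => c * series u n).
  exact: (cvg_mulCl c uU).
by apply/funext => n; rewrite /series /= mulr_sumr.
Qed.

Arguments cvg_seriesMl c {u U}.

Lemma cvg_seriesD2 (u v : nat -> C) (U V : C) :
    series u @ \oo --> U -> series v @ \oo --> V ->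
  series (fun i => u i + v i) @ \oo --> U + V.
Proof.
move=> uU vV; rewrite (_ : series _ = fun n => series u n + series v n).
  exact: (cvg_addC uU vV).
by apply/funext => n; rewrite /series /= big_split.
Qed.

Lemma cauchy_product (u v : nat -> C) (A B : nat -> R) (U V : C) :
    (forall n, modulus (u n) <= A n) -> cvgn (series A) ->
    (forall n, modulus (v n) <= B n) -> cvgn (series B) ->
    series u @ \oo --> U -> series v @ \oo --> V ->
  series (fun n => \sum_(i < n.+1) u i * v (n - i)%N) @ \oo --> U * V.
Proof.
move=> uA Ac vB Bc uU vV.
have B0 n : 0 <= B n by exact: le_trans (modulus_ge0 _) (vB n).
(* The partial sums of the Cauchy product are series in [i] that end at [N] and
   converge termwise to [u i * V]. *)
set c := (fun n => _).
have cE N : series c N = series (fun i => u i * series v (N - i)%N) N.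
  elim: N => [|N IH]; first by rewrite /series /= !big_geq.
  rewrite seriesSr IH /c seriesSr subSnn.
  have -> : series (fun i => u i * series v (N.+1 - i)%N) N =
      series (fun i => u i * series v (N - i)%N) N + \sum_(i < N) u i * v (N - i)%N.
    rewrite /series /= !big_mkord -big_split /=; apply: eq_bigr => i _.
    rewrite -mulrDr; congr (_ * _).
    by rewrite subSn ?(ltnW (ltn_ord i))// big_nat_recr.
  rewrite -addrA big_ord_recr /= subnn; congr (_ + (_ + _ * _)).
  by rewrite /series /= big_nat1.
set L := limn (series B).
have vL n : modulus (series v n) <= L.
  apply: le_trans (modulus_sum _ _ _) _.
  apply: le_trans (_ : series B n <= L); first by apply: ler_sum.
  apply: nondecreasing_cvgn_le => //.
  by apply/nondecreasing_seqP => k; rewrite seriesSr lerDl.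
apply: (@tannery R (fun N i => u i * series v (N - i)%N) (fun i => u i * V)
  (fun i => L * A i)).
- move=> N j; rewrite modulusM mulrC.
  by apply: ler_pM; rewrite ?modulus_ge0.
- exact: (@is_cvg_seriesZ R A L Ac).
- move=> j; apply: (cvg_mulCl (u j) (u := fun N => series v (N - j)%N)).
  rewrite -(cvg_shiftn j) (_ : (fun n => _) = series v)//.
  by apply/funext => n; rewrite addnK.
- move=> N; rewrite cE; apply: (@cvg_eventually_cst _ _ N) => n Nn.
  apply: series_eq0 Nn => i Ni.
  have /eqP -> : (N - i == 0)%N by rewrite subn_eq0.
  by rewrite /series /= big_geq// mulr0.
- by rewrite (_ : (fun i => _) = fun i => V * u i) 1?mulrC; [exact: cvg_seriesMl|
    apply/funext => i; rewrite mulrC].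
Qed.

(** The coefficients [a] satisfy a Cauchy estimate for the radius [r]. *)
Definition bounded_coef (a : nat -> C) (r : R) :=
  exists M, forall n, modulus (a n) * r ^+ n <= M.

(** The partial sums of the power series with coefficients [a] at [h]. *)
Definition pseries (a : nat -> C) (h : C) : nat -> C :=
  series (fun n => a n * h ^+ n).

(** On the open disc of radius [r] about [0], [f] is the sum of the power series
    with coefficients [a]. The Cauchy estimate, which pointwise convergence only
    gives on smaller discs, is part of the definition; the values of [f] outside
    the disc are irrelevant. *)
Definition has_pseries (a : nat -> C) (r : R) (f : C -> C) : Prop :=
  [/\ 0 < r, bounded_coef a r &
    forall h, modulus h < r -> pseries a h @ \oo --> f h].

Lemma pseries_term_bound (a : nat -> C) r M (h : C) s : 0 < r ->
    (forall n, modulus (a n) * r ^+ n <= M) -> modulus h <= s ->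
  forall n, modulus (a n * h ^+ n) <= M * (s / r) ^+ n.
Proof.
move=> r0 aM hs n; rewrite modulusM modulusX expr_div_n.
have rn0 : 0 < r ^+ n by rewrite exprn_gt0.
have hsn : modulus h ^+ n <= s ^+ n.
  by rewrite lerXn2r// nnegrE ?modulus_ge0// (le_trans (modulus_ge0 h)).
apply: (@le_trans _ _ (modulus (a n) * s ^+ n)).
  by rewrite ler_wpM2l ?modulus_ge0.
rewrite mulrA ler_pdivlMr// -mulrA (mulrC (s ^+ n)) mulrA ler_wpM2r//.
by rewrite exprn_ge0// (le_trans (modulus_ge0 h)).
Qed.

Lemma bounded_coef_ge0 (a : nat -> C) r M : 0 < r ->
  (forall n, modulus (a n) * r ^+ n <= M) -> 0 <= M.
Proof.
move=> r0 /(_ 0%N); apply: le_trans.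
by rewrite mulr_ge0 ?modulus_ge0// exprn_ge0// ltW.
Qed.

Lemma pseries_dom (a : nat -> C) (r s : R) : 0 < r -> bounded_coef a r ->
    0 <= s < r ->
  exists A : nat -> R, cvgn (series A) /\
    forall h : C, modulus h <= s -> forall n, modulus (a n * h ^+ n) <= A n.
Proof.
move=> r0 [M aM] /andP[s0 sr]; exists (fun n => M * (s / r) ^+ n); split.
  by apply: cvg_geometric_bound; rewrite divr_ge0 ?(ltW r0)//= ltr_pdivrMr// mul1r.
by move=> h hs; exact: pseries_term_bound.
Qed.

(** The sum of the power series [a] at [h]; meaningful where it converges. *)
Definition psum (a : nat -> C) (h : C) : C := limn (pseries a h).

Lemma psumP (a : nat -> C) r : 0 < r -> bounded_coef a r ->
  has_pseries a r (psum a).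
Proof.
move=> r0 ar; split=> // h hr.
have [A [Ac hA]] : exists A : nat -> R, cvgn (series A) /\
    forall z : C, modulus z <= modulus h -> forall n, modulus (a n * z ^+ n) <= A n.
  by apply: pseries_dom ar _ => //; rewrite modulus_ge0.
exact: series_dom_cvg (hA h _) Ac.
Qed.

Lemma pseries_cvg_psum (a : nat -> C) (h l : C) :
  pseries a h @ \oo --> l -> psum a h = l.
Proof. exact: (cvg_lim (@norm_hausdorff _ _)). Qed.

Lemma bounded_coefW (a : nat -> C) r r' : 0 <= r' <= r ->
  bounded_coef a r -> bounded_coef a r'.
Proof.
move=> /andP[r'0 r'r] [M aM]; exists M => n; apply: le_trans (aM n).
by rewrite ler_wpM2l ?modulus_ge0// lerXn2r// nnegrE// (le_trans r'0).
Qed.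

Lemma has_pseriesW (a : nat -> C) r r' f : 0 < r' <= r ->
  has_pseries a r f -> has_pseries a r' f.
Proof.
move=> /andP[r'0 r'r] [r0 ar af]; split=> //.
  by apply: bounded_coefW ar; rewrite ltW.
by move=> h hr; apply: af; rewrite (lt_le_trans hr).
Qed.

Lemma eq_has_pseries (a : nat -> C) r f g :
  (forall h, modulus h < r -> f h = g h) ->
  has_pseries a r f -> has_pseries a r g.
Proof.
move=> fg [r0 ar af]; split; [exact: r0|exact: ar|move=> h hr].
by rewrite -(fg h hr); exact: af.
Qed.

(** Convergence on a disc yields a Cauchy estimate on half of it, as the terms at
    [r / 2] tend to [0]. *)
Lemma has_pseries_of_cvg (a : nat -> C) r f : 0 < r ->
    (forall h, modulus h < r -> pseries a h @ \oo --> f h) ->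
  has_pseries a (r / 2) f.
Proof.
move=> r0 af; have r20 : 0 < r / 2 by rewrite divr_gt0.
split=> //; last by move=> h hr; apply: af; rewrite (lt_le_trans hr)//; lra.
have /af/cvgP/cvg_series_cvg_0 : modulus ((r / 2)%:C%C : C) < r.
  by rewrite modulus_real gtr0_norm//; lra.
move=> /cvg_modulusP/(_ _ ltr01)[N Ne].
exists (1 + \sum_(i < N) modulus (a i) * (r / 2) ^+ i) => n.
have t0 i : 0 <= modulus (a i) * (r / 2) ^+ i.
  by rewrite mulr_ge0 ?modulus_ge0// exprn_ge0// ltW.
have [nN|Nn] := ltnP n N.
  rewrite (bigD1 (Ordinal nN))//= addrCA lerDl addr_ge0//.
  by apply: sumr_ge0 => i _.
have := Ne n Nn; rewrite subr0 modulusM modulusX modulus_real gtr0_norm// => /ltW h1.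
by rewrite (le_trans h1)// lerDl sumr_ge0.
Qed.
End PowerSeries.
Arguments cvg_seriesMl {R} c {u U}.

(** * Operations on power series *)

Section PowerSeriesOps.
Variable R : realType.
Local Notation C := (R[i]^o).
Implicit Types (a b : nat -> C) (r : R) (f g : C -> C).

Lemma has_pseriesD a b r f g : has_pseries a r f -> has_pseries b r g ->
  has_pseries (fun n => a n + b n) r (fun h => f h + g h).
Proof.
move=> [r0 [M aM] af] [_ [M' bM] bg]; split; [exact: r0| |].
  exists (M + M') => n; apply: le_trans (lerD (aM n) (bM n)).
  by rewrite -mulrDl ler_wpM2r ?modulusD// exprn_ge0// ltW.
move=> h hr; rewrite /pseries (_ : (fun n => _) = fun n => a n * h ^+ n + b n * h ^+ n).
  by apply: cvg_seriesD2; [exact: af|exact: bg].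
by apply/funext => n; rewrite mulrDl.
Qed.

Lemma has_pseriesZ a r f (c : C) : has_pseries a r f ->
  has_pseries (fun n => c * a n) r (fun h => c * f h).
Proof.
move=> [r0 [M aM] af]; split; [exact: r0| |].
  exists (modulus c * M) => n.
  by rewrite modulusM -mulrA ler_wpM2l ?modulus_ge0.
move=> h hr; rewrite /pseries (_ : (fun n => _) = fun n => c * (a n * h ^+ n)).
  by apply: cvg_seriesMl; exact: af.
by apply/funext => n; rewrite mulrA.
Qed.

Lemma has_pseriesM a b r f g : has_pseries a r f -> has_pseries b r g ->
  has_pseries (fun n => \sum_(i < n.+1) a i * b (n - i)%N) (r / 2)
    (fun h => f h * g h).
Proof.
move=> [r0 ar af] [_ br bg].
have r20 : 0 < r / 2 by rewrite divr_gt0.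
have r2r : r / 2 < r by lra.
split; [exact: r20| |].
  have [M aM] := ar; have [M' bM] := br.
  have M0 := bounded_coef_ge0 r0 aM; have M'0 := bounded_coef_ge0 r0 bM.
  exists (M * M') => n; rewrite expr_div_n mulrA ler_pdivrMr ?exprn_gt0//.
  apply: (@le_trans _ _ (\sum_(i < n.+1) M * M')).
    apply: le_trans (_ : (\sum_(i < n.+1) modulus (a i * b (n - i)%N)) * r ^+ n <= _).
      by rewrite ler_wpM2r ?modulus_sum// exprn_ge0// ltW.
    rewrite mulr_suml; apply: ler_sum => i _; rewrite modulusM.
    have -> : r ^+ n = r ^+ i * r ^+ (n - i) by rewrite -exprD subnKC// -ltnS.
    rewrite mulrACA.
    by apply: ler_pM; rewrite ?mulr_ge0 ?modulus_ge0 ?exprn_ge0// ltW.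
  rewrite sumr_const card_ord -[leLHS]mulr_natr ler_wpM2l ?mulr_ge0//.
  by rewrite -natrX ler_nat ltn_expl.
move=> h hr; have hr' := lt_trans hr r2r.
have hh : 0 <= modulus h < r by rewrite modulus_ge0.
have [A [Ac aA]] := pseries_dom r0 ar hh.
have [B [Bc bB]] := pseries_dom r0 br hh.
have := cauchy_product (aA h (lexx _)) Ac (bB h (lexx _)) Bc (af _ hr') (bg _ hr').
apply: eq_cvg_series => n; rewrite mulr_suml; apply: eq_bigr => i _.
by rewrite mulrACA -exprD subnKC// -ltnS.
Qed.

(** Multiplication by a power of the variable shifts the coefficients. *)
Definition shift_coef k a : nat -> C := fun n => if (n < k)%N then 0 else a (n - k)%N.

Lemma has_pseries_shift a r f k : has_pseries a r f ->
  has_pseries (shift_coef k a) r (fun h => h ^+ k * f h).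
Proof.
move=> [r0 [M aM] af]; have M0 := bounded_coef_ge0 r0 aM; split; [exact: r0| |].
  exists (M * r ^+ k) => n; rewrite /shift_coef; case: ltnP => nk.
    by rewrite modulus0 mul0r mulr_ge0// exprn_ge0// ltW.
  have -> : r ^+ n = r ^+ (n - k) * r ^+ k by rewrite -exprD subnK.
  rewrite mulrA ler_wpM2r//.
  by rewrite exprn_ge0// ltW.
move=> h hr; have afh := af h hr.
rewrite -(cvg_shiftn k) (_ : (fun n => _) = fun n => h ^+ k * pseries a h n).
  exact: (cvg_mulCl _ afh).
apply/funext => n; rewrite /pseries addnC.
elim: n => [|n IH]; last first.
  rewrite addnS !seriesSr IH mulrDr; congr (_ + _).
  by rewrite /shift_coef ltnNge leq_addr/= addKn exprD mulrCA.
rewrite addn0 /series /= big_mkord big1 ?big_geq ?mulr0// => i _.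
by rewrite /shift_coef ltn_ord mul0r.
Qed.

Lemma has_pseries_scale a r f (l : C) : l != 0 -> has_pseries a r f ->
  has_pseries (fun n => a n * l ^+ n) (r / modulus l) (fun h => f (l * h)).
Proof.
move=> l0 [r0 [M aM] af]; have ml0 : 0 < modulus l by rewrite modulus_gt0.
split; first by rewrite divr_gt0.
  exists M => n; rewrite modulusM modulusX expr_div_n.
  by rewrite -mulrA (mulrC (modulus l ^+ n)) mulfVK// expf_neq0// gt_eqF.
move=> h; rewrite ltr_pdivlMr// mulrC -modulusM => /af.
by apply: eq_cvg_series => n; rewrite exprMn mulrA.
Qed.

Lemma has_pseries_cst r (c : C) : 0 < r ->
  has_pseries (fun n => if n == 0%N then c else 0) r (fun=> c).
Proof.
move=> r0; split; [exact: r0| |].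
  exists (modulus c) => -[|n]; first by rewrite mulr1.
  by rewrite modulus0 mul0r modulus_ge0.
move=> h _; apply: (@cvg_eventually_cst _ _ _ 1) => n n1.
rewrite /pseries (@series_eq0 _ _ 1 n)//; last by case=> // i _; rewrite mul0r.
by rewrite /series /= big_nat1 mulr1.
Qed.

Lemma has_pseries_addX r (c : C) : 0 < r ->
  exists a, has_pseries a r (fun h => c + h).
Proof.
move=> r0; have h1 := has_pseries_shift 1 (has_pseries_cst (1 : C) r0).
exists (fun n => (if n == 0%N then c else 0) +
  shift_coef 1 (fun n => if n == 0%N then 1 else 0) n).
apply: eq_has_pseries (has_pseriesD (has_pseries_cst c r0) h1) => h _.
by rewrite mulr1.
Qed.

Lemma cvg_geometricC (z : C) : modulus z < 1 ->
  series (fun n => z ^+ n) @ \oo --> (1 - z)^-1.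
Proof.
move=> z1; have z1' : 1 - z != 0.
  apply: contraTneq z1 => /eqP; rewrite subr_eq0 => /eqP <-.
  by rewrite modulus1 ltxx.
have zn : (fun n => z ^+ n) @ \oo --> (0 : C).
  apply/cvg_modulusP => e e0.
  have /cvgrPdist_lt/(_ _ e0)[N _ Ne] : (fun n => (modulus z) ^+ n) @ \oo --> (0 : R).
    by apply: cvg_expr; rewrite ger0_norm ?modulus_ge0.
  exists N => n /Ne /=; rewrite subr0 distrC subr0 ger0_norm ?exprn_ge0 ?modulus_ge0//.
  by rewrite modulusX.
rewrite (_ : series _ = fun n => (1 - z)^-1 * (1 - z ^+ n)).
  rewrite -[X in _ --> X]mulr1; apply: (cvg_mulCl _ (u := fun n => 1 - z ^+ n)).
  apply/cvg_modulusP => e e0; have /cvg_modulusP/(_ _ e0)[N Ne] := zn.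
  exists N => n /Ne; rewrite subr0.
  by rewrite (_ : 1 - z ^+ n - 1 = - z ^+ n) ?modulusN//; ring.
apply/funext => n; apply: (mulfI z1'); rewrite mulVKf//.
elim: n => [|n IH]; first by rewrite /series /= big_geq// mulr0 expr0 subrr.
by rewrite seriesSr mulrDr IH exprS; ring.
Qed.

Lemma has_pseries_inv (d : C) : d != 0 ->
  has_pseries (fun n => d^-1 * d^-1 ^+ n) (modulus d) (fun h => (d - h)^-1).
Proof.
move=> d0; have md : 0 < modulus d by rewrite modulus_gt0.
split; [exact: md| |].
  exists (modulus d)^-1 => n; rewrite modulusM modulusX modulusV exprVn mulfVK//.
  by rewrite expf_neq0// gt_eqF.
move=> h hd; have hd1 : modulus (d^-1 * h) < 1.
  by rewrite modulusM modulusV mulrC ltr_pdivrMr// mul1r.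
have := cvg_seriesMl d^-1 (cvg_geometricC hd1).
rewrite /pseries -invfM mulrBr mulr1 (mulVKf d0); apply: eq_cvg_series => n.
by rewrite exprMn mulrA.
Qed.

Lemma sum_bin_exp_le (x t : R) j N : 0 <= x -> 0 <= t ->
  \sum_(n < N) 'C(j, n)%:R * x ^+ (j - n) * t ^+ n <= (x + t) ^+ j.
Proof.
move=> x0 t0; rewrite exprDn.
pose F n := 'C(j, n)%:R * x ^+ (j - n) * t ^+ n.
have F0 n : 0 <= F n by rewrite !mulr_ge0 ?exprn_ge0.
have -> : \sum_(i < j.+1) x ^+ (j - i) * t ^+ i *+ 'C(j, i) = \sum_(0 <= i < j.+1) F i.
  by rewrite big_mkord; apply: eq_bigr => i _; rewrite -mulr_natl mulrA.
rewrite -(big_mkord predT F); have [Nj|/ltnW jN] := leqP N j.+1.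
  by rewrite [leRHS](big_cat_nat (leq0n _) Nj) /= lerDl sumr_ge0.
rewrite (big_cat_nat (leq0n _) jN) /= [X in _ + X]big_nat.
rewrite [X in _ + X]big1 ?addr0// => i /andP[ij _].
by rewrite /F bin_small// !mul0r.
Qed.

(** Coefficients of the expansion at [c] of the power series [b]. For [j < n] the
    truncated exponent [j - n] is harmless because ['C(j, n)] is [0]. *)
Definition recenter (b : nat -> C) (c : C) : nat -> C :=
  fun n => limn (series (fun j => b j * ('C(j, n)%:R * c ^+ (j - n)))).

(** Blocks of the binomial expansion of [b j * (c + h) ^ j] are dominated uniformly
    in the block and in [h]. *)
Lemma recenter_term_dom b r (c : C) s : 0 < r -> bounded_coef b r -> 0 < s ->
    modulus c + s < r -> exists A : nat -> R, cvgn (series A) /\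
  forall n N j (h : C), modulus h <= s ->
    modulus (\sum_(n <= i < N) b j * ('C(j, i)%:R * c ^+ (j - i)) * h ^+ i) <= A j.
Proof.
move=> r0 br s0 cs.
have cs0 : 0 <= modulus c + s < r by rewrite cs andbT addr_ge0 ?modulus_ge0// ltW.
have [A [Ac bA]] := pseries_dom r0 br cs0.
exists A; split=> // n N j h hs.
have : modulus (b j * ((modulus c + s)%:C%C : C) ^+ j) <= A j.
  by apply: bA; rewrite modulus_real ger0_norm//; case/andP: cs0.
apply: le_trans; rewrite modulusM modulusX modulus_real ger0_norm; last by case/andP: cs0.
apply: le_trans (ler_wpM2l (modulus_ge0 _) (sum_bin_exp_le j N (modulus_ge0 c) (ltW s0))).
apply: le_trans (modulus_sum _ _ _) _.
rewrite -(big_mkord predT (fun i => 'C(j, i)%:R * modulus c ^+ (j - i) * s ^+ i)) mulr_sumr.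
have F0 i : 0 <= modulus (b j) * ('C(j, i)%:R * modulus c ^+ (j - i) * s ^+ i).
  by rewrite !mulr_ge0 ?modulus_ge0 ?exprn_ge0 ?modulus_ge0// ltW.
have le1 i : modulus (b j * ('C(j, i)%:R * c ^+ (j - i)) * h ^+ i) <=
    modulus (b j) * ('C(j, i)%:R * modulus c ^+ (j - i) * s ^+ i).
  rewrite !modulusM !modulusX modulus_nat -!mulrA.
  do 3 (rewrite ler_wpM2l ?modulus_ge0 ?exprn_ge0 ?modulus_ge0//).
  by rewrite lerXn2r// nnegrE ?modulus_ge0// ltW.
have [Nn|nN] := leqP N n; first by rewrite [leLHS]big_geq// sumr_ge0.
rewrite (big_cat_nat (leq0n _) (ltnW nN)) /= -[leLHS]add0r lerD ?sumr_ge0//.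
exact: ler_sum.
Qed.

Lemma recenter_cvg b r (c : C) n : 0 < r -> bounded_coef b r ->
    modulus c < r ->
  series (fun j => b j * ('C(j, n)%:R * c ^+ (j - n))) @ \oo --> recenter b c n.
Proof.
move=> r0 br cr; pose s := (r - modulus c) / 2.
have s0 : 0 < s by rewrite divr_gt0// subr_gt0.
have css : modulus c + s < r by rewrite /s; lra.
have [A [Ac dom]] := recenter_term_dom r0 br s0 css.
have Ac' : cvgn (series (fun j => (s ^+ n)^-1 * A j)) by exact: (@is_cvg_seriesZ R A _ Ac).
apply: series_dom_cvg Ac' => j.
have sc : modulus (s%:C%C : C) = s by rewrite modulus_real gtr0_norm.
have := dom n n.+1 j (s%:C%C); rewrite sc => /(_ (lexx _)).
rewrite big_nat1 modulusM modulusX sc mulrC => h.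
by rewrite ler_pdivlMl ?exprn_gt0.
Qed.

Lemma has_pseries_recenter b r f (c : C) : has_pseries b r f -> modulus c < r ->
  has_pseries (recenter b c) ((r - modulus c) / 2) (fun h => f (c + h)).
Proof.
move=> [r0 br bf] cr; pose s := (r - modulus c) / 2.
have s0 : 0 < s by rewrite divr_gt0// subr_gt0.
have css : modulus c + s < r by rewrite /s; lra.
have [A [Ac dom]] := recenter_term_dom r0 br s0 css.
have sc : modulus (s%:C%C : C) = s by rewrite modulus_real gtr0_norm.
have rc := fun n => @recenter_cvg b r c n r0 br cr.
have A0 j : 0 <= A j.
  by apply: le_trans (dom 0%N 0%N j 0 _); rewrite ?modulus_ge0 ?modulus0 ?ltW.
split; [exact: s0| |].
  exists (limn (series A)) => n.
  rewrite -/s -sc -modulusX -modulusM mulrC.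
  apply: cvg_modulus_le (cvg_seriesMl ((s%:C%C : C) ^+ n) (rc n)) _ => J.
  apply: le_trans (modulus_sum _ _ _) _.
  apply: le_trans (_ : series A J <= _).
    apply: ler_sum => j _; rewrite mulrC.
    by have := dom n n.+1 j (s%:C%C); rewrite sc big_nat1; apply.
  apply: nondecreasing_cvgn_le => //.
  by apply/nondecreasing_seqP => k; rewrite seriesSr lerDl.
move=> h /ltW hs.
apply: (@tannery R
  (fun N j => \sum_(0 <= i < N) b j * ('C(j, i)%:R * c ^+ (j - i)) * h ^+ i)
  (fun j => b j * (c + h) ^+ j) A).
- by move=> N j; exact: dom.
- exact: Ac.
- move=> j; apply: (@cvg_eventually_cst _ _ _ j.+1) => N Nj.
  rewrite (big_cat_nat (leq0n _) Nj) /= [X in _ + X]big_nat [X in _ + X]big1 ?addr0.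
    rewrite exprDn mulr_sumr big_mkord; apply: eq_bigr => i _.
    by rewrite -[X in _ = _ * X]mulr_natl -!mulrA.
  by move=> i /andP[ij _]; rewrite bin_small// mul0r mulr0 mul0r.
- move=> N; elim: N => [|N IH].
    have -> : pseries (recenter b c) h 0 = 0 by rewrite /pseries /series /= big_geq.
    apply: (@cvg_eventually_cst _ _ _ 0) => n _.
    by rewrite /series /= big1// => i _; rewrite big_geq.
  have -> : pseries (recenter b c) h N.+1 =
      pseries (recenter b c) h N + h ^+ N * recenter b c N.
    by rewrite {1}/pseries seriesSr [X in _ + X]mulrC.
  apply: eq_cvg_series (cvg_seriesD2 IH (cvg_seriesMl (h ^+ N) (rc N))) => j.
  by rewrite big_nat_recr //= [X in _ + X]mulrC.
- apply: bf; apply: le_lt_trans (modulusD _ _) _; apply: le_lt_trans css.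
  by rewrite lerD2l.
Qed.

(** A power series whose sum vanishes along a sequence of nonzero points
    tending to the centre is zero. *)
Lemma has_pseries_eq0 a r f (x : nat -> C) : has_pseries a r f ->
    x @ \oo --> (0 : C) -> (forall k, x k != 0) -> (forall k, modulus (x k) <= r / 2) ->
    (forall k, f (x k) = 0) ->
  forall n, a n = 0.
Proof.
move=> [r0 ar af] x0 xn0 xr fx n.
have r2 : 0 <= r / 2 < r by lra.
have [M aM] := ar.
(* The lower coefficients vanish, so dividing by [x k ^ n] leaves a series whose
   limit as [k] grows is [a n]. *)
elim/ltn_ind: n => n IH.
pose b j := a (n + j)%N.
have br : bounded_coef b r.
  exists (M / r ^+ n) => j; rewrite ler_pdivlMr ?exprn_gt0// -mulrA -exprD addnC.
  exact: aM.
have [A [Ac bA]] := pseries_dom r0 br r2.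
have b0 k : pseries b (x k) @ \oo --> (0 : C).
  have : pseries a (x k) @ \oo --> (0 : C).
    by rewrite -(fx k); apply: af; rewrite (le_lt_trans (xr k))//; lra.
  rewrite -(cvg_shiftn n) => h.
  have := cvg_mulCl ((x k ^+ n)^-1) h; rewrite mulr0.
  rewrite (_ : (fun _ => _) = pseries b (x k))//; apply/funext => j /=.
  apply: (mulfI (expf_neq0 n (xn0 k))); rewrite mulVKf ?expf_neq0//.
  rewrite /pseries addnC; elim: j => [|j IHj].
    rewrite addn0 /series /= big_nat big1 ?big_geq ?mulr0//.
    by move=> i /andP[_ /IH ->]; rewrite mul0r.
  rewrite addnS !seriesSr IHj mulrDr; congr (_ + _).
  by rewrite exprD mulrCA.
have h : (fun=> 0 : C) @ \oo --> a n.
  apply: (@tannery R (fun k j => b j * x k ^+ j)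
    (fun j => if j == 0%N then a n else 0) A).
  - by move=> k j; exact: bA.
  - exact: Ac.
  - case=> [|j] /=.
      by apply: (@cvg_eventually_cst _ _ _ 0) => k _; rewrite mulr1 /b addn0.
    rewrite (_ : (fun N => _) = fun N => b j.+1 * x N ^+ j * x N); last first.
      by apply/funext => N; rewrite exprSr mulrA.
    have bd : forall N, modulus (b j.+1 * x N ^+ j) <= modulus (b j.+1) * (r / 2) ^+ j.
      move=> N; rewrite modulusM modulusX ler_wpM2l ?modulus_ge0//.
      by rewrite lerXn2r// nnegrE ?modulus_ge0//; lra.
    set K := modulus _ * _ in bd.
    have K0 : 0 <= K by apply: le_trans (bd 0%N); exact: modulus_ge0.
    apply/cvg_modulusP => e e0.
    have eK : 0 < e / (K + 1) by rewrite divr_gt0// ltr_wpDl.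
    have /cvg_modulusP/(_ _ eK)[N Ne] := x0; exists N => k /Ne; rewrite !subr0 => xk.
    rewrite modulusM; apply: le_lt_trans (ler_wpM2r (modulus_ge0 _) (bd k)) _.
    rewrite ltr_pdivlMr ?ltr_wpDl// in xk; apply: le_lt_trans xk.
    by rewrite mulrC ler_wpM2l ?modulus_ge0// lerDl.
  - exact: b0.
  - apply: (@cvg_eventually_cst _ _ _ 1) => N N1.
    rewrite (@series_eq0 _ _ 1 N)//; last by case.
    by rewrite /series /= big_nat1.
exact: (cvg_unique (@norm_hausdorff _ _) h (@cvg_cst C 0 nat \oo _)).
Qed.

End PowerSeriesOps.

(** * Regular points, Laurent expansions and residues *)

Section Laurent.
Variable R : realType.
Local Notation C := (R[i]^o).
Implicit Types (a b : nat -> C) (f g : C -> C) (c : C) (r : R).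

Lemma regular_atP f c :
  regular_at f c <-> exists a r, has_pseries a r (fun h => f (c + h)).
Proof.
split=> [[a /nearcP[r [r0 ar]]]|[a [r [r0 _ ar]]]].
  exists a, (r / 2); apply: has_pseries_of_cvg => // h hr.
  by have := ar h hr; rewrite addrC addKr.
exists a; apply/nearcP; exists r; split=> // h hr.
have -> : c + h - c = h by rewrite addrC addKr.
exact: ar.
Qed.

Lemma laurent_atP f c N a : laurent_at f c N a <->
  exists r g, has_pseries a r g /\
    forall h, h != 0 -> modulus h < r -> g h = h ^+ N * f (c + h).
Proof.
split=> [/nearc_dnbhsP[r [r0 ar]]|[r [g [[r0 _ ar] gf]]]]; last first.
  apply/nearc_dnbhsP; exists r; split=> // h h0 hr.
  have -> : c + h - c = h by rewrite addrC addKr.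
  by rewrite -(gf h h0 hr); exact: ar.
(* The value at the centre is not prescribed by the Laurent expansion. *)
exists (r / 2), (fun h => if h == 0 then a 0%N else h ^+ N * f (c + h)).
have r2 : r / 2 < r by lra.
split; last by move=> h /negPf ->.
apply: has_pseries_of_cvg => // h hr; have [->|h0] := eqVneq h 0; last first.
  have := ar h h0 hr.
  have -> : c + h - c = h by rewrite addrC addKr.
  exact.
apply: (@cvg_eventually_cst _ _ _ 1) => n n1.
rewrite /pseries (@series_eq0 _ _ 1 n)//; last by case=> // i _; rewrite expr0n mulr0.
by rewrite /series /= big_nat1 mulr1.
Qed.

Lemma regular_at_near f g c r : 0 < r ->
    (forall h, modulus h < r -> f (c + h) = g (c + h)) ->
  regular_at f c -> regular_at g c.
Proof.
move=> r0 fg /regular_atP[a [s aS]]; apply/regular_atP.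
have s0 : 0 < s by case: aS.
exists a, (Num.min r s); apply: (@eq_has_pseries _ _ _ (fun h => f (c + h))).
  by move=> h; rewrite lt_min => /andP[/fg].
by apply: has_pseriesW aS; rewrite lt_min r0 s0 ge_min lexx orbT.
Qed.

Lemma has_pseries_min a b r s f g : has_pseries a r f -> has_pseries b s g ->
  exists2 t, has_pseries a t f & has_pseries b t g.
Proof.
move=> aS bS; have r0 : 0 < r by case: aS.
have s0 : 0 < s by case: bS.
exists (Num.min r s).
  by apply: has_pseriesW aS; rewrite lt_min r0 s0 ge_min lexx.
by apply: has_pseriesW bS; rewrite lt_min r0 s0 ge_min lexx orbT.
Qed.

Lemma regular_atD f g c : regular_at f c -> regular_at g c ->
  regular_at (fun z => f z + g z) c.
Proof.
move=> /regular_atP[a [r aS]] /regular_atP[b [s bS]]; apply/regular_atP.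
have [t at_ bt] := has_pseries_min aS bS.
by exists (fun n => a n + b n), t; exact: has_pseriesD at_ bt.
Qed.

Lemma regular_atM f g c : regular_at f c -> regular_at g c ->
  regular_at (fun z => f z * g z) c.
Proof.
move=> /regular_atP[a [r aS]] /regular_atP[b [s bS]]; apply/regular_atP.
have [t at_ bt] := has_pseries_min aS bS.
by eexists; exists (t / 2); exact: has_pseriesM at_ bt.
Qed.

Lemma regular_at_cst (k : C) c : regular_at (fun=> k) c.
Proof. by apply/regular_atP; eexists; exists 1; exact: has_pseries_cst. Qed.

Lemma regular_at_id c : regular_at id c.
Proof.
apply/regular_atP; have [a aS] := has_pseries_addX c (@ltr01 R).
by exists a, 1.
Qed.

Lemma regular_at_scale f (l c : C) : l != 0 -> regular_at f (l * c) ->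
  regular_at (fun z => f (l * z)) c.
Proof.
move=> l0 /regular_atP[a [r aS]]; apply/regular_atP.
eexists; exists (r / modulus l).
apply: eq_has_pseries (has_pseries_scale l0 aS) => h _.
by rewrite mulrDr.
Qed.

Lemma regular_at_inv c : c != 1 -> regular_at (fun z => (1 - z)^-1) c.
Proof.
move=> c1; have d0 : 1 - c != 0 by rewrite subr_eq0 eq_sym.
apply/regular_atP; eexists; exists (modulus (1 - c)).
apply: eq_has_pseries (has_pseries_inv d0) => h _.
by rewrite opprD addrA.
Qed.

Lemma regular_at_psum b r c : 0 < r -> bounded_coef b r -> modulus c < r ->
  regular_at (psum b) c.
Proof.
move=> r0 br cr; apply/regular_atP; exists (recenter b c), ((r - modulus c) / 2).
exact: has_pseries_recenter (psumP r0 br) cr.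
Qed.

(** Meromorphy at a single point. *)
Definition mero_at f c := exists N a, laurent_at f c N a.

Lemma mero_at_near f g c r : 0 < r ->
    (forall h, h != 0 -> modulus h < r -> f (c + h) = g (c + h)) ->
  mero_at f c -> mero_at g c.
Proof.
move=> r0 fg [N [a /laurent_atP[s [k [aS kf]]]]].
have s0 : 0 < s by case: aS.
exists N, a; apply/laurent_atP; exists (Num.min r s), k; split.
  by apply: has_pseriesW aS; rewrite lt_min r0 s0 ge_min lexx orbT.
by move=> h h0; rewrite lt_min => /andP[hr hs]; rewrite kf// fg.
Qed.

Lemma laurent_at_pad f c N a k : laurent_at f c N a ->
  laurent_at f c (k + N) (shift_coef k a).
Proof.
move=> /laurent_atP[r [g [aS gf]]]; apply/laurent_atP.
exists r, (fun h => h ^+ k * g h); split; first exact: has_pseries_shift.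
by move=> h h0 hr; rewrite gf// mulrA -exprD.
Qed.

Lemma laurent_atD f g c N a b : laurent_at f c N a -> laurent_at g c N b ->
  laurent_at (fun z => f z + g z) c N (fun n => a n + b n).
Proof.
move=> /laurent_atP[r [f' [aS ff]]] /laurent_atP[s [g' [bS gg]]].
have r0 : 0 < r by case: aS.
have s0 : 0 < s by case: bS.
apply/laurent_atP; exists (Num.min r s), (fun h => f' h + g' h); split.
  apply: has_pseriesD.
    by apply: has_pseriesW aS; rewrite lt_min r0 s0 ge_min lexx.
  by apply: has_pseriesW bS; rewrite lt_min r0 s0 ge_min lexx orbT.
by move=> h h0; rewrite lt_min => /andP[hr hs]; rewrite ff// gg// mulrDr.
Qed.

Lemma laurent_atZ f c N a (k : C) : laurent_at f c N a ->
  laurent_at (fun z => k * f z) c N (fun n => k * a n).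
Proof.
move=> /laurent_atP[r [f' [aS ff]]].
apply/laurent_atP; exists r, (fun h => k * f' h); split; first exact: has_pseriesZ.
by move=> h h0 hr; rewrite ff// mulrCA.
Qed.

Lemma mero_atD f g c : mero_at f c -> mero_at g c ->
  mero_at (fun z => f z + g z) c.
Proof.
move=> [N [a aL]] [M [b bL]]; exists (M + N)%N.
eexists; apply: laurent_atD; first exact: laurent_at_pad aL.
by rewrite addnC; exact: laurent_at_pad bL.
Qed.

Lemma mero_atM f g c : mero_at f c -> mero_at g c ->
  mero_at (fun z => f z * g z) c.
Proof.
move=> [N [a /laurent_atP[r [f' [aS ff]]]]] [M [b /laurent_atP[s [g' [bS gg]]]]].
have r0 : 0 < r by case: aS.
have s0 : 0 < s by case: bS.
pose t := Num.min r s; have t0 : 0 < t by rewrite lt_min r0.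
exists (N + M)%N; eexists; apply/laurent_atP; exists (t / 2), (fun h => f' h * g' h); split.
  apply: has_pseriesM.
    by apply: has_pseriesW aS; rewrite t0 ge_min lexx.
  by apply: has_pseriesW bS; rewrite t0 ge_min lexx orbT.
move=> h h0 ht; have : modulus h < t by lra.
by rewrite lt_min => /andP[hr hs]; rewrite ff// gg// mulrACA -exprD.
Qed.

Lemma mero_at_regular f c : regular_at f c -> mero_at f c.
Proof.
move=> /regular_atP[a [r aS]]; exists 0%N, a; apply/laurent_atP.
by exists r, (fun h => f (c + h)); split=> // h _ _; rewrite mul1r.
Qed.

Lemma mero_at_scale f (l c : C) : l != 0 -> mero_at f (l * c) ->
  mero_at (fun z => f (l * z)) c.
Proof.
move=> l0 [N [a /laurent_atP[r [f' [aS ff]]]]].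
exists N; eexists; apply/laurent_atP; exists (r / modulus l).
exists (fun h => l^-1 ^+ N * f' (l * h)); split.
  exact: has_pseriesZ (has_pseries_scale l0 aS).
move=> h h0; rewrite ltr_pdivlMr ?modulus_gt0// mulrC -modulusM => hr.
by rewrite ff ?mulf_neq0// mulrA -exprMn mulKf// mulrDr.
Qed.

Lemma mero_at_inv c : mero_at (fun z => (1 - z)^-1) c.
Proof.
have [->|c1] := eqVneq c 1; last exact/mero_at_regular/regular_at_inv.
exists 1%N; eexists; apply/laurent_atP; exists 1, (fun=> -1); split.
  exact: has_pseries_cst.
move=> h h0 _; rewrite opprD addrA subrr add0r expr1 invrN mulrN mulfV//.
Qed.

(** The identity principle, along the segment to the left of the centre. *)
Lemma has_pseries_left_eq0 a r f : has_pseries a r f ->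
  (forall t : R, 0 < t < r -> f (- t%:C%C) = 0) -> forall n, a n = 0.
Proof.
move=> aS f0; have r0 : 0 < r by case: aS.
pose t (k : nat) : R := r / 2 / k.+1%:R.
have t0 k : 0 < t k by rewrite !divr_gt0.
have tr k : t k <= r / 2.
  by rewrite /t ler_pdivrMr// ler_peMr ?ler1n//; lra.
apply: (has_pseries_eq0 (x := fun k => - (t k)%:C%C) aS).
- apply/cvg_modulusP => e e0.
  exists (Num.truncn (r / 2 / e)) => n.
  move=> h; rewrite subr0 modulusN modulus_real gtr0_norm//.
  rewrite /t ltr_pdivrMr// [ltRHS]mulrC -ltr_pdivrMr//.
  by apply: lt_le_trans (truncnS_gt _) _; rewrite ler_nat ltnS.
- move=> k; rewrite oppr_eq0; apply/eqP => /complexI /eqP.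
  by rewrite gt_eqF.
- by move=> k; rewrite modulusN modulus_real gtr0_norm.
- by move=> k; apply: f0; rewrite t0/= (le_lt_trans (tr k))//; lra.
Qed.

(** The coefficient of [(z - c) ^ -1] does not depend on the bound chosen for the
    order of the pole. *)
Lemma laurent_at_uniq f c N M a b :
  laurent_at f c N.+1 a -> laurent_at f c M.+1 b -> a N = b M.
Proof.
move=> aL bL.
have {}aL := laurent_at_pad M.+1 aL; have {}bL := laurent_at_pad N.+1 bL.
have /laurent_atP[r [g [gS g0]]] := laurent_atD aL
  (laurent_atZ (-1) (eq_rect _ (fun n => laurent_at f c n _) bL _ (addnC _ _))).
have := has_pseries_left_eq0 gS _ (N + M).+1.
have -> : shift_coef M.+1 a (N + M).+1 = a N.
  by rewrite /shift_coef ltnNge -addnS leq_addl/= addnK.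
have -> : shift_coef N.+1 b (N + M).+1 = b M.
  by rewrite /shift_coef ltnNge -addSn leq_addr/= addKn.
rewrite mulN1r => /(_ _)/eqP; rewrite subr_eq0 => h; apply/eqP/h => t /andP[t0 tr].
rewrite g0 ?modulusN ?modulus_real ?gtr0_norm//; first by rewrite mulN1r subrr mulr0.
by rewrite oppr_eq0; apply/eqP => /complexI /eqP; rewrite gt_eqF.
Qed.

(** [has_residue f c x]: [f] is meromorphic at [c], with residue [x]. *)
Definition has_residue f c (x : C) :=
  exists N a, laurent_at f c N.+1 a /\ x = a N.

Lemma has_residueE f c x : has_residue f c x -> residue f c = x.
Proof.
move=> fx; rewrite /residue; case: xgetP => [y _ [N [a [aL ->]]]|/(_ x)//].
by have [M [b [bL ->]]] := fx; exact: laurent_at_uniq aL bL.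
Qed.

Lemma has_residueD f g c x y : has_residue f c x -> has_residue g c y ->
  has_residue (fun z => f z + g z) c (x + y).
Proof.
move=> [N [a [aL ->]]] [M [b [bL ->]]].
exists (M.+1 + N)%N; eexists; split.
  apply: laurent_atD.
    by rewrite -addnS; exact: laurent_at_pad aL.
  by rewrite addnC -addSn; exact: laurent_at_pad bL.
congr (_ + _); rewrite /shift_coef.
  by rewrite ltnNge leq_addr/= addKn.
by rewrite addSnnS ltnNge leq_addl/= addnK.
Qed.

Lemma has_residueZ f c x (k : C) : has_residue f c x ->
  has_residue (fun z => k * f z) c (k * x).
Proof.
move=> [N [a [aL ->]]]; exists N; eexists; split; first exact: laurent_atZ aL.
by [].
Qed.

Lemma has_residue0 c : has_residue (fun=> 0) c 0.
Proof.
exists 0%N, (fun n => if n == 0%N then 0 else 0); split=> //; apply/laurent_atP.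
exists 1, (fun=> 0); split; first exact: has_pseries_cst.
by move=> h _ _; rewrite mulr0.
Qed.

Lemma has_residue_sum I (s : seq I) (F : I -> C -> C) (x : I -> C) c :
    (forall i, has_residue (F i) c (x i)) ->
  has_residue (fun z => \sum_(i <- s) F i z) c (\sum_(i <- s) x i).
Proof.
move=> Fx; elim: s => [|i s IH].
  rewrite big_nil (_ : (fun z => _) = fun=> 0); first exact: has_residue0.
  by apply/funext => z; rewrite big_nil.
rewrite big_cons (_ : (fun z => _) = fun z => F i z + \sum_(i <- s) F i z).
  exact: has_residueD.
by apply/funext => z; rewrite big_cons.
Qed.

(** A quotient of a power series by a power of the variable: its residue is
    read off the coefficients. *)
Lemma has_residue_pseries f g c a r p : has_pseries a r g ->
    (forall h, h != 0 -> modulus h < r -> h ^+ p.+1 * f (c + h) = g h) ->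
  has_residue f c (a p).
Proof.
move=> aS fg; exists p, a; split=> //; apply/laurent_atP.
by exists r, g; split=> // h h0 hr; rewrite fg.
Qed.

End Laurent.

(** * Linear extension and the stuffle product *)

Section LinearExtension.
Variables (V : zmodType) (act : rat -> V -> V).
Hypothesis actDl : forall c d v, act (c + d) v = act c v + act d v.
Hypothesis actDr : forall c u v, act c (u + v) = act c u + act c v.
Hypothesis actM : forall c d v, act (c * d) v = act c (act d v).
Hypothesis act1 : forall v, act 1 v = v.

(** The linear extension of a function on words, for an action [act] of the
    rationals on [V]. The action is a parameter: it is scaling when [V] is [QB], and
    multiplication through [ratr] when [V] is the complex field. *)
Definition lext (f : seq nat -> V) (x : QB) : V :=
  \sum_(w <- msupp x) act (mcoeff w x) (f w).

(** Linearity over the rationals with respect to [act]. *)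
Definition qlinear (f : QB -> V) :=
  forall c x y, f (c *: x + y) = act c (f x) + f y.

Lemma act0 v : act 0 v = 0.
Proof. by apply: (addrI (act 0 v)); rewrite -actDl !addr0. Qed.

Lemma act0r c : act c 0 = 0.
Proof. by apply: (addrI (act c 0)); rewrite -actDr !addr0. Qed.

Lemma lextEw f (d : {fset fmonom nat}) x : (msupp x `<=` d)%fset ->
  lext f x = \sum_(w <- d) act (mcoeff w x) (f w).
Proof.
move=> xd; rewrite /lext (big_fset_incl _ xd)//= => w _ /mcoeff_outdom ->.
by rewrite act0.
Qed.

Lemma lext_qlinear f : qlinear (lext f).
Proof.
move=> c x y; pose d := (msupp (c *: x + y) `|` (msupp x `|` msupp y))%fset.
rewrite (@lextEw f d (c *: x + y)) ?fsubsetUl//.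
rewrite (@lextEw f d x); last first.
  by rewrite (fsubset_trans (fsubsetUl _ (msupp y)))// fsubsetUr.
rewrite (@lextEw f d y); last first.
  by rewrite (fsubset_trans (fsubsetUr (msupp x) _))// fsubsetUr.
have -> : forall s : seq (fmonom nat),
    act c (\sum_(w <- s) act (mcoeff w x) (f w)) =
    \sum_(w <- s) act c (act (mcoeff w x) (f w)).
  elim=> [|w s IH]; first by rewrite !big_nil act0r.
  by rewrite !big_cons actDr IH.
rewrite -big_split /=; apply: eq_bigr => w _.
by rewrite mcoeffD mcoeffZ actDl actM.
Qed.

Lemma lext_word f w : lext f (word w) = f w.
Proof. by rewrite (lextEw f msuppU_le) big_seq_fset1 mcoeffUU act1. Qed.

Lemma qlinear0 f : qlinear f -> f 0 = 0.
Proof.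
move=> fl; have := fl 1 0 0; rewrite scaler0 addr0 act1 => h.
by apply: (addrI (f 0)); rewrite addr0 -h.
Qed.

Lemma qlinearD f : qlinear f -> {morph f : x y / x + y}.
Proof. by move=> fl x y; rewrite -[x]scale1r fl act1 scale1r. Qed.

Lemma qlinearZ f : qlinear f -> forall c x, f (c *: x) = act c (f x).
Proof. by move=> fl c x; rewrite -[c *: x]addr0 fl qlinear0// addr0. Qed.

Lemma qlinear_add f g : qlinear f -> qlinear g -> qlinear (fun x => f x + g x).
Proof. by move=> fl gl c x y; rewrite fl gl actDr addrACA. Qed.

End LinearExtension.

Lemma QB_ind (P : QB -> Prop) : P 0 ->
    (forall c w x, P x -> P (c *: word w + x)) -> forall u, P u.
Proof.
move=> P0 PD u; rewrite (monalgE u).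
elim: (enum_fset (msupp u)) => [|w s IH]; first by rewrite big_nil.
rewrite big_cons; have -> : mkmalgU w (mcoeff w u) = mcoeff w u *: word w.
  apply/malgP => k; rewrite mcoeffZ !mcoeffU fmK.
  by rewrite mulr_natr.
exact: PD.
Qed.

Lemma qlinear_eq (V : zmodType) (act : rat -> V -> V) (f g : QB -> V) :
    (forall v, act 1 v = v) -> qlinear act f -> qlinear act g ->
  (forall w, f (word w) = g (word w)) -> f =1 g.
Proof.
move=> act1 fl gl fg; apply: QB_ind => [|c w x IH].
  by rewrite (qlinear0 act1 fl) (qlinear0 act1 gl).
by rewrite fl gl fg IH.
Qed.

Lemma word_nil : word [::] = 1.
Proof. by rewrite /word; congr (mkmalgU _ _); rewrite /mone /one /= fmoneE. Qed.

Lemma word_cat u v : word (u ++ v) = word u * word v.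
Proof.
rewrite /word malgM_def fgmulUU mulr1; congr (mkmalgU _ _).
by rewrite -[RHS]fmK fmM.
Qed.

Lemma letterE a : letter a = word [:: a]. Proof. by []. Qed.

Lemma word_cons a u : word (a :: u) = letter a * word u.
Proof. by rewrite -cat1s word_cat. Qed.

Lemma word_rcons u a : word (rcons u a) = word u * letter a.
Proof. by rewrite -cats1 word_cat. Qed.

Lemma malgC_central (c : rat) (x : QB) : x * malgC c = malgC c * x.
Proof.
rewrite !malgM_def fgmulUg fgmulgU; apply: eq_bigr => w _.
by rewrite mulrC mul1m mulm1.
Qed.

Lemma msupp_word w : msupp (word w) = [fset (FMonom w)]%fset.
Proof. by rewrite /word msuppU1. Qed.

(* From here on these are used only through their lemmas, never through their
   representation by finitely supported functions. *)
Local Opaque word letter fgmul fgadd fgopp fgscale fgone fgzero mkmalgU.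

Lemma QB_scaleAr (c : rat) (x y : QB) : x * (c *: y) = c *: (x * y).
Proof.
rewrite -(mul_malgC c y) -(mul_malgC c (x * y)).
by rewrite (mulrA x (malgC c) y) malgC_central (mulrA (malgC c) x y).
Qed.

Local Notation qlin := (@qlinear QB *:%R).

Lemma qlin_mull (x : QB) f : qlin f -> qlin (fun y => x * f y).
Proof. by move=> fl c y z; rewrite fl mulrDr QB_scaleAr. Qed.

Lemma qlin_mulr (x : QB) f : qlin f -> qlin (fun y => f y * x).
Proof. by move=> fl c y z; rewrite fl mulrDl scalerAl. Qed.

Lemma qlin_id : qlin id.
Proof. by []. Qed.

Lemma qlin_comp (V : zmodType) act (f : QB -> V) g :
  qlinear act f -> qlin g -> qlinear act (fun x => f (g x)).
Proof. by move=> fl gl c x y; rewrite gl fl. Qed.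

Lemma qlin_add f g : qlin f -> qlin g -> qlin (fun x => f x + g x).
Proof. by apply: qlinear_add => c u v; rewrite scalerDr. Qed.

Lemma qlin_eq f g : qlin f -> qlin g -> (forall w, f (word w) = g (word w)) ->
  f =1 g.
Proof. exact: (qlinear_eq (@scale1r _ _)). Qed.

Lemma lextQ_qlin (f : seq nat -> QB) : qlin (lext *:%R f).
Proof.
apply: lext_qlinear => *; by rewrite ?scalerDl ?scalerDr ?scalerA.
Qed.

Lemma stuffleE x y : stuffle x y =
  lext *:%R (fun u => lext *:%R (stuffle_word u) y) x.
Proof.
apply: eq_bigr => u _; rewrite scaler_sumr; apply: eq_bigr => v _.
by rewrite scalerA.
Qed.

Local Opaque stuffle.

Lemma stuffle_qlinl y : qlin (stuffle^~ y).
Proof. by move=> c x z; rewrite !stuffleE lextQ_qlin. Qed.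

Lemma stuffle_qlinr x : qlin (stuffle x).
Proof.
move=> c y z; rewrite !stuffleE /lext scaler_sumr -big_split /=.
apply: eq_bigr => u _.
by have := lextQ_qlin (stuffle_word u) c y z; rewrite /lext => ->;
  rewrite scalerDr !scalerA mulrC.
Qed.

Lemma lextQ_word (f : seq nat -> QB) w : lext *:%R f (word w) = f w.
Proof. by apply: lext_word => *; rewrite ?scalerDl ?scalerDr ?scalerA ?scale1r. Qed.

Lemma stuffle_wordE u v : stuffle (word u) (word v) = stuffle_word u v.
Proof. by rewrite stuffleE !lextQ_word. Qed.

Lemma stuffle_word_cons a u b v : stuffle_word (a :: u) (b :: v) =
  letter a * stuffle_word u (b :: v) + letter b * stuffle_word (a :: u) v
    + letter (a + b)%N * stuffle_word u v.
Proof. by []. Qed.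

Lemma stuffle_word1 u : stuffle_word u [::] = word u.
Proof. by case: u. Qed.

Lemma stuffle1 x : stuffle x 1 = x.
Proof.
apply: (qlin_eq (stuffle_qlinl 1) qlin_id) => w.
by rewrite -word_nil stuffle_wordE stuffle_word1.
Qed.

Lemma stuffle_consE a b X Y : stuffle (letter a * X) (letter b * Y) =
  letter a * stuffle X (letter b * Y) + letter b * stuffle (letter a * X) Y
    + letter (a + b)%N * stuffle X Y.
Proof.
have ll k Z : qlin (fun X => stuffle (letter k * X) Z).
  exact: qlin_comp (stuffle_qlinl Z) (qlin_mull (letter k) qlin_id).
have lr k Z : qlin (fun Y => stuffle Z (letter k * Y)).
  exact: qlin_comp (stuffle_qlinr Z) (qlin_mull (letter k) qlin_id).
pose rhs X Y := letter a * stuffle X (letter b * Y) +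
  letter b * stuffle (letter a * X) Y + letter (a + b)%N * stuffle X Y.
have rl Z : qlin (rhs^~ Z).
  exact: (qlin_add (qlin_add (qlin_mull (letter a) (stuffle_qlinl _))
    (qlin_mull (letter b) (ll a Z))) (qlin_mull _ (stuffle_qlinl Z))).
have rr Z : qlin (rhs Z).
  exact: (qlin_add (qlin_add (qlin_mull (letter a) (lr b Z))
    (qlin_mull (letter b) (stuffle_qlinr _))) (qlin_mull _ (stuffle_qlinr Z))).
rewrite -/(rhs X Y); apply: (qlin_eq (ll a (letter b * Y)) (rl Y) _ X) => u.
apply: (qlin_eq (lr b (letter a * word u)) (rr (word u)) _ Y) => v; rewrite /rhs.
have := stuffle_word_cons a u b v; rewrite -!stuffle_wordE !word_cons.
exact.
Qed.

(** Left stuffle multiplication by the letter [b_0]. *)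
Definition stuffle0 (x : QB) : QB := stuffle (letter 0) x.

Lemma stuffle0_qlin : qlin stuffle0.
Proof. exact: stuffle_qlinr. Qed.

Lemma stuffle0_1 : stuffle0 1 = letter 0.
Proof. exact: stuffle1. Qed.

Lemma stuffle0_cons a X : stuffle0 (letter a * X) =
  letter 0 * (letter a * X) + letter a * stuffle0 X + letter a * X.
Proof.
have l1 : qlin (fun X => stuffle0 (letter a * X)).
  exact: qlin_comp stuffle0_qlin (qlin_mull (letter a) qlin_id).
have l2 : qlin (fun X => letter 0 * (letter a * X) + letter a * stuffle0 X + letter a * X).
  exact: (qlin_add (qlin_add (qlin_mull (letter 0) (qlin_mull (letter a) qlin_id))
    (qlin_mull (letter a) stuffle0_qlin)) (qlin_mull (letter a) qlin_id)).
apply: (qlin_eq l1 l2 _ X) => v.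
have : stuffle_word [:: 0%N] (a :: v) =
  letter 0 * word (a :: v) + letter a * stuffle_word [:: 0%N] v + letter a * word v by [].
rewrite -!stuffle_wordE -(letterE 0) word_cons; exact.
Qed.

(** The two steps of the induction proving [stuffle0_rcons] are identities in any
    ring. *)
Section RconsStep.
Variables (A : pzRingType) (D : A -> A) (b0 a b W : A).

Lemma stuffle0_rcons_nil_step : D 1 = b0 ->
    (forall X, D (a * X) = b0 * (a * X) + a * D X + a * X) ->
  D (1 * a) = D 1 * a + 1 * a * b0 + 1 * a.
Proof. by move=> D1 Da; rewrite !mul1r -{1}[a]mulr1 Da D1 !mulr1. Qed.

Lemma stuffle0_rcons_cons_step :
    (forall X, D (b * X) = b0 * (b * X) + b * D X + b * X) ->
    D (W * a) = D W * a + W * a * b0 + W * a ->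
  D (b * W * a) = D (b * W) * a + b * W * a * b0 + b * W * a.
Proof.
move=> Db DW; rewrite -mulrA !Db DW !mulrDl !mulrDr !mulrA !addrA.
by rewrite [LHS](ACl (1*2*4*3*5)).
Qed.

End RconsStep.

(** [stuffle0] computed from the last letter: [b_0] is inserted after [b_a], merged
    with [b_a], or goes further to the left. *)
Lemma stuffle0_rcons a X : stuffle0 (X * letter a) =
  stuffle0 X * letter a + X * letter a * letter 0 + X * letter a.
Proof.
have l1 : qlin (fun X => stuffle0 (X * letter a)).
  exact: qlin_comp stuffle0_qlin (qlin_mulr (letter a) qlin_id).
have l2 : qlin (fun X => stuffle0 X * letter a + X * letter a * letter 0 + X * letter a).
  exact: (qlin_add (qlin_add (qlin_mulr (letter a) stuffle0_qlin)
    (qlin_mulr (letter 0) (qlin_mulr (letter a) qlin_id))) (qlin_mulr (letter a) qlin_id)).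
apply: (qlin_eq l1 l2 _ X).
elim=> [|b w IH].
  rewrite word_nil; exact: (stuffle0_rcons_nil_step stuffle0_1 (stuffle0_cons a)).
rewrite word_cons; exact: (stuffle0_rcons_cons_step (stuffle0_cons b) IH).
Qed.

(** * Stuffle powers of the letter of index zero *)

(** Inductive steps for [stuffle0_stuffle] and [stuffle0_pow], again valid in any
    ring; [S] stands for the stuffle product and [D] for [stuffle0]. *)
Section StuffleZeroStep.
Variables (A : pzRingType) (D : A -> A) (S : A -> A -> A).
Variables (b0 a b c X Y : A).
Hypothesis DD : {morph D : x y / x + y}.
Hypothesis SD : forall x, {morph S x : y z / y + z}.

Lemma stuffle0_stuffle_step :
    (forall Z, D (a * Z) = b0 * (a * Z) + a * D Z + a * Z) ->
    (forall Z, D (b * Z) = b0 * (b * Z) + b * D Z + b * Z) ->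
    (forall Z, D (c * Z) = b0 * (c * Z) + c * D Z + c * Z) ->
    (forall Z, S (a * X) (b * Z) = a * S X (b * Z) + b * S (a * X) Z + c * S X Z) ->
    (forall Z, S (a * X) (b0 * Z) = a * S X (b0 * Z) + b0 * S (a * X) Z + a * S X Z) ->
    D (S X (b * Y)) = S X (D (b * Y)) ->
    D (S (a * X) Y) = S (a * X) (D Y) -> D (S X Y) = S X (D Y) ->
  D (S (a * X) (b * Y)) = S (a * X) (D (b * Y)).
Proof.
move=> Da Db Dc Sb S0 IH1 IH2 IH3.
rewrite Db !SD S0 Sb !DD Da Db Dc IH1 IH2 IH3 Db !SD Sb.
rewrite !mulrDr !addrA.
by rewrite [LHS](ACl (2*1*6*9*4*3*7*10*5*8*11)).
Qed.

Lemma stuffle0_zeros p :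
    (forall Z, D (Z * b0) = D Z * b0 + Z * b0 * b0 + Z * b0) ->
  D (X * b0 ^+ p) = D X * b0 ^+ p + (X * b0 ^+ p.+1 + X * b0 ^+ p) *+ p.
Proof.
move=> D0; elim: p => [|p IH]; first by rewrite !mulr1 mulr0n addr0.
rewrite exprSr mulrA D0 IH mulrDl mulrnAl mulrDl -!mulrA -!exprSr.
by rewrite mulrSr !addrA (mulrA (b0 ^+ p)) -!exprSr.
Qed.

End StuffleZeroStep.

Lemma trailing_step1 (A : pzRingType) (b : A) p :
  (b * b ^+ p + (1 * b ^+ p.+1 + 1 * b ^+ p) *+ p) - (1 * b ^+ p) *+ p =
  (1 * b ^+ p.+1) *+ p.+1.
Proof. by rewrite !mul1r mulrnDl addrA addrK -exprS -mulrS. Qed.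

Lemma trailing_stepS (A : pzRingType) (V a b Y : A) p :
  ((Y * a + V * a * b + V * a) * b ^+ p + (V * a * b ^+ p.+1 + V * a * b ^+ p) *+ p)
    - ((V * a * b ^+ p) *+ p.+1 + Y * a * b ^+ p) =
  (V * a * b ^+ p.+1) *+ p.+1.
Proof.
rewrite !mulrDl -(mulrA (V * a) b) -exprS mulrnDl !mulrS.
apply/eqP; rewrite subr_eq !addrA.
by rewrite [X in X == _](ACl (2*4*3*5*1)).
Qed.


(** Stuffle multiplication by [b_0] commutes with every left stuffle
    multiplication; hence [v * b_0 ^ j] is the [j]-fold iterate of [stuffle0]. *)
Lemma stuffle0_stuffle x y : stuffle0 (stuffle x y) = stuffle x (stuffle0 y).
Proof.
have SD z : {morph stuffle z : x y / x + y}.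
  by apply: (qlinearD (@scale1r _ _)); exact: stuffle_qlinr.
have DD : {morph stuffle0 : x y / x + y}.
  by apply: (qlinearD (@scale1r _ _)); exact: stuffle0_qlin.
have l1 z : qlin (fun y => stuffle0 (stuffle z y)).
  exact: qlin_comp stuffle0_qlin (stuffle_qlinr z).
have l2 z : qlin (fun y => stuffle z (stuffle0 y)).
  exact: qlin_comp (stuffle_qlinr z) stuffle0_qlin.
have l3 z : qlin (fun x => stuffle0 (stuffle x z)).
  exact: qlin_comp stuffle0_qlin (stuffle_qlinl z).
have l4 z : qlin (fun x => stuffle x (stuffle0 z)) := stuffle_qlinl (stuffle0 z).
apply: (qlin_eq (l3 y) (l4 y) _ x) => u; apply: (qlin_eq (l1 _) (l2 _) _ y) => v {x y}.
elim: u v => [|a u IHu] v.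
  have s1 Y : stuffle (word [::]) Y = Y.
    apply: (qlin_eq (stuffle_qlinr (word [::])) qlin_id) => w.
    exact: stuffle_wordE.
  by rewrite !s1.
elim: v => [|b v IHv].
  have h Y : stuffle Y (letter 0) = stuffle0 Y.
    move: Y; apply: (qlin_eq (stuffle_qlinl _) stuffle0_qlin); elim=> [|c w IH].
      rewrite word_nil stuffle0_1 -word_nil (letterE 0); exact: stuffle_wordE.
    have := stuffle_word_cons c w 0 [::].
    rewrite !stuffle_word1 (addn0 c) -!stuffle_wordE -(letterE 0) IH word_cons => ->.
    have swap (A : zmodType) (x y z : A) : x + y + z = y + x + z.
      by rewrite (addrC x).
    by rewrite (stuffle0_cons c (word w)); exact: swap.
  rewrite word_nil (stuffle1 (word (a :: u))) stuffle0_1 h; exact: erefl.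
rewrite !word_cons in IHv *.
apply: (stuffle0_stuffle_step (c := letter (a + b)) DD SD).
- exact: stuffle0_cons.
- exact: stuffle0_cons.
- exact: stuffle0_cons.
- by move=> Z; exact: stuffle_consE.
- by move=> Z; have := stuffle_consE a 0 (word u) Z; rewrite (addn0 a).
- by have := IHu (b :: v); rewrite word_cons.
- exact: IHv.
- exact: IHu.
Qed.

Lemma stuffle_expE v j : stuffle v (stuffle_exp (letter 0) j) = iter j stuffle0 v.
Proof.
have -> : stuffle_exp (letter 0) j = iter j stuffle0 1 by [].
elim: j => [|j IH]; first exact: stuffle1.
by rewrite !iterS -stuffle0_stuffle IH.
Qed.

Lemma word_nseq0 p : word (nseq p 0%N) = letter 0 ^+ p.
Proof.
by elim: p => [|p IH]; [exact: word_nil|rewrite exprS -IH -word_cons].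
Qed.

Lemma stuffle0_pow X p : stuffle0 (X * letter 0 ^+ p) =
  stuffle0 X * letter 0 ^+ p + (X * letter 0 ^+ p.+1 + X * letter 0 ^+ p) *+ p.
Proof. by apply: stuffle0_zeros => Z; exact: stuffle0_rcons. Qed.

(** Every word is an admissible word followed by some letters [b_0]. *)
Lemma word_split (w : seq nat) :
  exists v p, w = v ++ nseq p 0%N /\ last 1%N v != 0%N.
Proof.
elim/last_ind: w => [|w k [v [p [-> vl]]]]; first by exists [::], 0%N.
have [->|k0] := eqVneq k 0%N; last first.
  by exists (rcons (v ++ nseq p 0%N) k), 0%N; rewrite cats0 last_rcons.
exists v, p.+1; split=> //; rewrite -cats1 -catA; congr (_ ++ _).
by rewrite -(addn1 p) nseqD.
Qed.

Section Decomposition.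

Lemma QB0_0 : QB0 0.
Proof. by move=> w; rewrite msupp0. Qed.

Lemma QB0_word v : last 1%N v != 0%N -> QB0 (word v).
Proof. by move=> vl w; rewrite msupp_word in_fset1 => /eqP ->. Qed.

Lemma QB0_D x y : QB0 x -> QB0 y -> QB0 (x + y).
Proof.
move=> x0 y0 w /(fsubsetP (msuppD_le _ _)); rewrite in_fsetU.
by case/orP => [/x0|/y0].
Qed.

Lemma QB0_Z c x : QB0 x -> QB0 (c *: x).
Proof. by move=> x0 w /(fsubsetP (msuppZ_le _ _)) /x0. Qed.

(** The polynomial in the stuffle powers of [b_0] with coefficients [s], evaluated
    by Horner's scheme. *)
Definition horner0 (s : seq QB) : QB := foldr (fun v x => v + stuffle0 x) 0 s.

(** [u] is a polynomial in the stuffle powers of [b_0] with coefficients in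
    [QB0]. *)
Definition QB0_span (u : QB) : Prop :=
  exists2 s, forall i, QB0 (nth 0 s i) & u = horner0 s.

Let D0 : stuffle0 0 = 0.
Proof. exact: (qlinear0 (@scale1r _ _) stuffle0_qlin). Qed.

Let DD : {morph stuffle0 : x y / x + y}.
Proof. by apply: (qlinearD (@scale1r _ _)); exact: stuffle0_qlin. Qed.

Let DZ c x : stuffle0 (c *: x) = c *: stuffle0 x.
Proof. exact: (qlinearZ (@scale1r _ _) stuffle0_qlin). Qed.

Lemma QB0_span_QB0 u : QB0 u -> QB0_span u.
Proof.
move=> u0; exists [:: u]; last by rewrite /= D0 addr0.
by case=> [|[|i]] //=; exact: QB0_0.
Qed.

Lemma QB0_span_stuffle0 u : QB0_span u -> QB0_span (stuffle0 u).
Proof.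
move=> [s s0 ->]; exists (0 :: s); last by rewrite /= add0r.
by case=> [|i] /=; [exact: QB0_0|exact: s0].
Qed.

Lemma QB0_span_D x y : QB0_span x -> QB0_span y -> QB0_span (x + y).
Proof.
move=> [s s0 ->] [t t0 ->]; elim: s t s0 t0 => [|u s IH] t s0 t0.
  by exists t => //; rewrite /= add0r.
case: t t0 => [|v t] t0; first by exists (u :: s) => //; rewrite /= addr0.
have [||r r0 rE] := IH t; [by move=> i; exact: (s0 i.+1)|by move=> i; exact: (t0 i.+1)|].
exists (u + v :: r); last by rewrite /= -rE DD addrACA.
by case=> [|i] /=; [apply: QB0_D; [exact: (s0 0%N)|exact: (t0 0%N)]|exact: r0].
Qed.

Lemma QB0_span_Z c x : QB0_span x -> QB0_span (c *: x).
Proof.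
move=> [s s0 ->]; elim: s s0 => [|u s IH] s0.
  by exists [::] => //; rewrite /= scaler0.
have [|r r0 rE] := IH; first by move=> i; exact: (s0 i.+1).
exists (c *: u :: r); last by rewrite /= -rE DZ scalerDr.
by case=> [|i] /=; [apply: QB0_Z; exact: (s0 0%N)|exact: r0].
Qed.

Lemma QB0_span_Mn x n : QB0_span x -> QB0_span (x *+ n).
Proof. by rewrite -scaler_nat; exact: QB0_span_Z. Qed.

Lemma QB0_span_N x : QB0_span x -> QB0_span (- x).
Proof. by rewrite -scaleN1r; exact: QB0_span_Z. Qed.

Lemma QB0_span_Mn_inv x n : QB0_span (x *+ n.+1) -> QB0_span x.
Proof.
move=> /(QB0_span_Z (n.+1%:R^-1)); rewrite -scaler_nat scalerA mulVf ?scale1r//.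
by rewrite pnatr_eq0.
Qed.

(** Induction on the number of trailing letters [b_0]: solve the formula for
    [stuffle0 (v b_0 ^ p)] for the term [v b_0 ^ (p + 1)]. *)
Lemma QB0_span_pow p v : last 1%N v != 0%N ->
  QB0_span (word v * letter 0 ^+ p).
Proof.
elim: p v => [|p IH] v vl; first by rewrite mulr1; apply/QB0_span_QB0/QB0_word.
have Dv := QB0_span_stuffle0 (IH v vl); rewrite stuffle0_pow in Dv.
have FS := IH v vl.
apply: (@QB0_span_Mn_inv _ p).
case/lastP: v vl Dv FS => [|v a] vl Dv FS.
  rewrite word_nil stuffle0_1 in Dv FS *.
  rewrite -(@trailing_step1 QB _ _); apply: QB0_span_D Dv _.
  exact/QB0_span_N/QB0_span_Mn.
rewrite last_rcons in vl.
have X : forall X, QB0_span (X * letter a * letter 0 ^+ p).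
  have XS (c : rat) (x y : QB) : (c *: x + y) * letter a * letter 0 ^+ p =
      c *: (x * letter a * letter 0 ^+ p) + y * letter a * letter 0 ^+ p.
    exact: (qlin_mulr (letter 0 ^+ p) (qlin_mulr (letter a) qlin_id)).
  apply: QB_ind => [|c w X IHX].
    by rewrite !mul0r; exact/QB0_span_QB0/QB0_0.
  rewrite XS; apply: QB0_span_D IHX; apply: QB0_span_Z.
  by rewrite -word_rcons; apply: IH; rewrite last_rcons.
rewrite word_rcons in Dv FS *; rewrite stuffle0_rcons in Dv.
rewrite -(@trailing_stepS QB (word v) (letter a) (letter 0) (stuffle0 (word v)) p).
by apply: QB0_span_D Dv _; apply/QB0_span_N/QB0_span_D; [exact: QB0_span_Mn|exact: X].
Qed.

Lemma QB0_spanP u : QB0_span u.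
Proof.
move: u; apply: QB_ind => [|c w x IH]; first exact/QB0_span_QB0/QB0_0.
apply: QB0_span_D IH; apply: QB0_span_Z; have [v [p [-> vl]]] := word_split w.
by rewrite word_cat word_nseq0; exact: QB0_span_pow.
Qed.

Lemma horner0E s : horner0 s = \sum_(j < size s) iter j stuffle0 (nth 0 s j).
Proof.
elim: s => [|u s IH]; first by rewrite big_ord0.
rewrite big_ord_recl /= IH; congr (_ + _).
by rewrite (big_morph _ DD D0); apply: eq_bigr => i _.
Qed.

Lemma reg_decomposition_exists u : exists k v, reg_decomposition u k v.
Proof.
have [s s0 ->] := QB0_spanP u; exists (size s), (nth 0 s); split=> [j _|].
  exact: s0.
rewrite big_ord_recr /= nth_default// stuffle_expE.
rewrite (iter_fix _ D0).
by rewrite addr0 horner0E; apply: eq_bigr => j _; rewrite stuffle_expE.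
Qed.

Lemma reg_decompositionE u k v : reg_decomposition u k v ->
  u = \sum_(j < k.+1) iter j stuffle0 (v j).
Proof.
by move=> [_ ->]; apply: eq_bigr => j _; rewrite stuffle_expE.
Qed.

(** The value of [reg] is the constant coefficient of some decomposition. *)
Lemma regP u : exists k v, reg_decomposition u k v /\ reg u = v 0%N.
Proof.
have [k [v kv]] := reg_decomposition_exists u; rewrite /reg.
case: xgetP => [x -> [k' [v' [kv' ->]]]|/(_ (v 0%N))]; first by exists k', v'.
by case; exists k, v.
Qed.

End Decomposition.

(** * Coefficients of the generating series of a word *)

Section Alpha.
Variables (K : comNzRingType) (x : nat -> K).

(** [alpha w M] is the sum of [\prod_j x_(m_j) ^ k_j] over the increasing
    sequences [0 < m_1 < ... < m_d = M], where [w = b_(k_1) ... b_(k_d)]; for the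
    empty word it is the indicator of [M = 0]. *)
Definition alpha (w : seq nat) : nat -> K :=
  foldl (fun s k m => x m ^+ k * \sum_(i < m) s i) (fun m => (m == 0%N)%:R) w.

Lemma alpha_nil m : alpha [::] m = (m == 0%N)%:R.
Proof. by []. Qed.

Lemma alpha_rcons w k m :
  alpha (rcons w k) m = x m ^+ k * \sum_(i < m) alpha w i.
Proof. by rewrite /alpha foldl_rcons. Qed.

Lemma alpha_rcons0 w k : alpha (rcons w k) 0%N = 0.
Proof. by rewrite alpha_rcons big_ord0 mulr0. Qed.

End Alpha.

Lemma sum_sum_ord (K : comNzRingType) (s : nat -> K) N :
  \sum_(m < N) m%:R * s m + \sum_(m < N) \sum_(i < m) s i =
  (N%:R - 1) * \sum_(m < N) s m.
Proof.
elim: N => [|N IH]; first by rewrite !big_ord0 mulr0 addr0.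
rewrite !big_ord_recr /= addrACA IH -natr1; ring.
Qed.

(** The induction on words behind [sum_alphaQ_stuffle0], for abstract operations. *)
Section PartialSums.
Variables (A : pzRingType) (K : comNzRingType) (al : A -> nat -> K).
Variables (D : A -> A) (xa : nat -> K) (W a b : A).
Hypothesis alD : forall y z m, al (y + z) m = al y m + al z m.
Hypothesis ala : forall X m, al (X * a) m = xa m * \sum_(i < m) al X i.
Hypothesis alb : forall X m, al (X * b) m = \sum_(i < m) al X i.

Lemma partial_sums_nil : D 1 = b -> (forall m, al 1 m = (m == 0%N)%:R) ->
  forall N, \sum_(m < N) al (D 1) m = (N%:R - 1) * \sum_(m < N) al 1 m.
Proof.
move=> -> al1 N; rewrite -sum_sum_ord [X in _ = X + _]big1 ?add0r => [|m _].
  by apply: eq_bigr => m _; rewrite -[b]mul1r alb.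
by rewrite al1; case: (m : nat) => [|?]; rewrite ?mul0r ?mulr0.
Qed.

Lemma partial_sums_rcons : D (W * a) = D W * a + W * a * b + W * a ->
    (forall N, \sum_(m < N) al (D W) m = (N%:R - 1) * \sum_(m < N) al W m) ->
  forall N, \sum_(m < N) al (D (W * a)) m =
    (N%:R - 1) * \sum_(m < N) al (W * a) m.
Proof.
move=> DW IH N; rewrite -sum_sum_ord -big_split; apply: eq_bigr => m _ /=.
rewrite DW !alD alb (ala (D W)) IH (ala W).
move: (\sum_(i < m) al W i) (\sum_(i < m) _) => S T; ring.
Qed.

End PartialSums.

Section AlphaExt.
Variables (R : realType) (x : nat -> R[i]^o).
Local Notation C := (R[i]^o).

(** The action of the rationals on [C]. *)
Definition cact (c : rat) (z : C) : C := ratr c * z.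
Local Notation clin := (@qlinear C cact).

(** Linear extension of a complex function on words. *)
Definition cext (f : seq nat -> C) (u : QB) : C := lext cact f u.

Lemma cactDl c d z : cact (c + d) z = cact c z + cact d z.
Proof. by rewrite /cact rmorphD mulrDl. Qed.
Lemma cactDr c y z : cact c (y + z) = cact c y + cact c z.
Proof. by rewrite /cact mulrDr. Qed.
Lemma cactM c d z : cact (c * d) z = cact c (cact d z).
Proof. by rewrite /cact rmorphM mulrA. Qed.
Lemma cact1 z : cact 1 z = z.
Proof. by rewrite /cact rmorph1 mul1r. Qed.

Lemma cext_lin f : clin (cext f).
Proof. exact: (lext_qlinear cactDl cactDr cactM). Qed.

Lemma cext_word f w : cext f (word w) = f w.
Proof. exact: (lext_word cactDl cact1). Qed.

Lemma clin_mul (k : C) f : clin f -> clin (fun u => k * f u).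
Proof. by move=> fl c y z; rewrite fl mulrDr /cact mulrCA. Qed.

Lemma clin_sum N (f : nat -> QB -> C) :
  (forall i, clin (f i)) -> clin (fun u => \sum_(i < N) f i u).
Proof.
move=> fl c y z; rewrite /cact mulr_sumr -big_split /=.
by apply: eq_bigr => i _; rewrite fl.
Qed.

Lemma clin_eq f g : clin f -> clin g -> (forall w, f (word w) = g (word w)) ->
  f =1 g.
Proof. exact: (qlinear_eq cact1). Qed.

(** The linear extension of [alpha], one index at a time. *)
Definition alphaQ (u : QB) (m : nat) : C := cext (fun w => alpha x w m) u.

Lemma alphaQ_lin m : clin (alphaQ^~ m).
Proof. exact: cext_lin. Qed.

Lemma alphaQ_word w m : alphaQ (word w) m = alpha x w m.
Proof. exact: cext_word. Qed.

Lemma alphaQ_rcons X k m :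
  alphaQ (X * letter k) m = x m ^+ k * \sum_(i < m) alphaQ X i.
Proof.
have l1 : clin (fun X => alphaQ (X * letter k) m).
  exact: qlin_comp (alphaQ_lin m) (qlin_mulr (letter k) qlin_id).
have l2 : clin (fun X => x m ^+ k * \sum_(i < m) alphaQ X i).
  exact: (@clin_mul (x m ^+ k) _ (@clin_sum m (fun i X => alphaQ X i) alphaQ_lin)).
apply: (clin_eq l1 l2 _ X) => w.
rewrite -word_rcons alphaQ_word alpha_rcons; congr (_ * _).
by apply: eq_bigr => i _; rewrite alphaQ_word.
Qed.

(** Truncated sums turn the stuffle product by [b_0] into multiplication by
    the number of available indices. *)
Lemma sum_alphaQ_stuffle0 u N : \sum_(m < N) alphaQ (stuffle0 u) m =
  (N%:R - 1) * \sum_(m < N) alphaQ u m.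
Proof.
have l1 M : clin (fun u => \sum_(m < M) alphaQ (stuffle0 u) m).
  exact: (@clin_sum M (fun i u => alphaQ (stuffle0 u) i)
    (fun i => qlin_comp (alphaQ_lin i) stuffle0_qlin)).
have l2 M : clin (fun u => (M%:R - 1) * \sum_(m < M) alphaQ u m).
  exact: (@clin_mul (M%:R - 1) _ (@clin_sum M (fun i X => alphaQ X i) alphaQ_lin)).
apply: (clin_eq (l1 N) (l2 N) _ u) => w.
have alD y z m : alphaQ (y + z) m = alphaQ y m + alphaQ z m.
  exact: (qlinearD cact1 (alphaQ_lin m)).
have al0 X m : alphaQ (X * letter 0) m = \sum_(i < m) alphaQ X i.
  by rewrite alphaQ_rcons expr0 mul1r.
elim/last_ind: w N => [|w a IH] N.
  rewrite word_nil; apply: (partial_sums_nil al0 stuffle0_1) => m.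
  by rewrite -word_nil alphaQ_word.
rewrite word_rcons.
exact: (partial_sums_rcons alD (fun X => alphaQ_rcons X a) al0
  (stuffle0_rcons a (word w)) IH).
Qed.

Lemma alphaQ_stuffle0_rcons X a m :
  alphaQ (stuffle0 X * letter a) m = (m%:R - 1) * alphaQ (X * letter a) m.
Proof.
have h1 := alphaQ_rcons (stuffle0 X) a m; have h2 := alphaQ_rcons X a m.
rewrite sum_alphaQ_stuffle0 mulrCA in h1.
exact: etrans h1 (congr1 _ (esym h2)).
Qed.

End AlphaExt.

(** * Growth of the coefficients *)

Section AlphaBounds.
Variables (R : realType).
Local Notation C := (R[i]^o).

Lemma alpha_ge0 (y : nat -> R) w m : (forall i, 0 <= y i) -> 0 <= alpha y w m.
Proof.
move=> y0; elim/last_ind: w m => [|w k IH] m; first exact: ler0n.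
by rewrite alpha_rcons mulr_ge0 ?exprn_ge0// sumr_ge0.
Qed.

Lemma modulus_alpha (x : nat -> C) w m :
  modulus (alpha x w m) <= alpha (fun i => modulus (x i)) w m.
Proof.
elim/last_ind: w m => [|w k IH] m; first by rewrite modulus_nat.
rewrite !alpha_rcons modulusM modulusX ler_wpM2l ?exprn_ge0 ?modulus_ge0//.
by rewrite (le_trans (modulus_sum _ _ _))// ler_sum.
Qed.

(** [b ^ m] is at most each of the [m] terms of the geometric sum. *)
Lemma mulr_natexp_bound (b : R) m : 0 <= b < 1 -> m%:R * b ^+ m <= (1 - b)^-1.
Proof.
move=> /andP[b0 b1]; have b1' : 0 < 1 - b by rewrite subr_gt0.
apply: (@le_trans _ _ (\sum_(i < m) b ^+ i)).
  have -> : m%:R * b ^+ m = \sum_(i < m) b ^+ m.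
    by rewrite sumr_const card_ord mulr_natl.
  by apply: ler_sum => i _; apply: ler_wiXn2l; rewrite ?(ltW b1) ?(ltnW (ltn_ord i)).
rewrite -[leRHS]mul1r ler_pdivlMr//.
have := subrX1 b m; have := exprn_ge0 m b0; move: (b ^+ m) (\sum_(i < m) _) => u s.
nra.
Qed.

(** If [y m] decays like [r ^ m], then the coefficients of a word ending with [b_k]
    grow less than [t ^ (- m)] for every [t < r ^ (- k)]. *)
Lemma alpha_bound (y : nat -> R) (K r : R) w t : 0 < r < 1 ->
    (forall m, 0 <= y m <= K * r ^+ m) -> 0 < t -> t * r ^+ last 0%N w < 1 \/ w = [::] ->
  exists M, forall m, alpha y w m * t ^+ m <= M.
Proof.
move=> /andP[r0 r1] yK; have y0 m : 0 <= y m by case/andP: (yK m).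
have K0 : 0 <= K by have /andP[_] := yK 0%N; rewrite mulr1; exact: le_trans.
elim/last_ind: w t => [|w k IH] t t0 tr.
  exists 1 => -[|m]; rewrite alpha_nil ?mulr1// mul0r; exact: ler01.
have {}tr : t * r ^+ k < 1.
  by case: tr => [|/(congr1 size)]; rewrite ?last_rcons ?size_rcons.
(* A radius [s] strictly between [t * r ^ k] and [1] leaves room for the factor
   [m] coming from the partial sum. *)
pose th := t * r ^+ k; have th0 : 0 < th by rewrite mulr_gt0 ?exprn_gt0.
pose s := (1 + th) / 2; have [s0 s1 ths] : [/\ 0 < s, s < 1 & th < s].
  by rewrite /s; move: (tr); rewrite -/th => ?; split; lra.
have sr : s * r ^+ last 0%N w < 1.
  apply: le_lt_trans s1; apply: (ler_piMr (ltW s0)).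
  by apply: exprn_ile1; rewrite ltW.
have [M aM] := IH s s0 (or_introl sr).
have M0 : 0 <= M by apply: le_trans (aM 0%N); rewrite mulr1; exact: alpha_ge0.
have b01 : 0 <= th / s < 1 by rewrite divr_ge0 ?ltW//= ltr_pdivrMr// mul1r.
exists (K ^+ k * M * (1 - th / s)^-1) => m; rewrite alpha_rcons.
have h1 : \sum_(i < m) alpha y w i <= m%:R * (M / s ^+ m).
  have -> : m%:R * (M / s ^+ m) = \sum_(i < m) M / s ^+ m.
    by rewrite sumr_const card_ord mulr_natl.
  apply: ler_sum => i _; rewrite ler_pdivlMr ?exprn_gt0//.
  apply: le_trans (aM i); rewrite ler_wpM2l ?alpha_ge0//.
  by apply: ler_wiXn2l; rewrite ?(ltW s0) ?(ltW s1) ?(ltnW (ltn_ord i)).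
have h2 : y m ^+ k <= K ^+ k * r ^+ (m * k).
  have /andP[_ h] := yK m; rewrite exprM -exprMn lerXn2r// nnegrE//.
  by rewrite mulr_ge0// exprn_ge0// ltW.
have S0 : 0 <= \sum_(i < m) alpha y w i by apply: sumr_ge0 => i _; exact: alpha_ge0.
have tm0 : 0 <= t ^+ m by rewrite exprn_ge0// ltW.
apply: le_trans (ler_wpM2r tm0 (ler_pM _ S0 h2 h1)) _; first by rewrite exprn_ge0.
have -> : K ^+ k * r ^+ (m * k) * (m%:R * (M / s ^+ m)) * t ^+ m =
    K ^+ k * M * (m%:R * (th / s) ^+ m).
  have -> : (th / s) ^+ m = t ^+ m * r ^+ (m * k) / s ^+ m.
    by rewrite expr_div_n; congr (_ / _); rewrite /th exprMn -exprM mulnC.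
  by move: (s ^+ m)^-1 => si; ring.
by rewrite ler_wpM2l ?mulr_ge0 ?exprn_ge0// mulr_natexp_bound.
Qed.

End AlphaBounds.

(** * Unconditional sums over increasing sequences *)

Section Exhaustion.
Variables (R : realType) (I : choiceType).
Local Notation C := (R[i]^o).

(** An absolutely summable family can be summed along any exhaustion by
    finite sets. *)
Lemma sum_exhaustion (f : I -> C) (E : nat -> {fset I}) (B : R) (l : C) :
    (forall n m, (n <= m)%N -> (E n `<=` E m)%fset) ->
    (forall i, exists n, i \in E n) ->
    (forall n, \sum_(i <- E n) modulus (f i) <= B) ->
    (fun n => \sum_(i <- E n) f i) @ \oo --> l ->
  summability.sum f = l.
Proof.
move=> Emono Ecov EB El.
have tF : ProperFilter (@summability.totally I) := summability.totally_filter.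
rewrite /summability.sum.
apply: (@cvg_lim _ (@norm_hausdorff _ _) _ _ tF).
pose s n := \sum_(i <- E n) modulus (f i).
have subS (A A' : {fset I}) : (A `<=` A')%fset ->
    \sum_(i <- A) modulus (f i) <= \sum_(i <- A') modulus (f i).
  move=> AA'; rewrite (big_fsetID _ (mem A) A')/=.
  have -> : [fset x in A' | x \in A]%fset = A.
    by apply/fsetP => x; rewrite !inE/= andb_idl// => /(fsubsetP AA').
  by rewrite lerDl sumr_ge0// => i _; exact: modulus_ge0.
have sc : cvgn s.
  apply: nondecreasing_is_cvgn.
    by move=> n m /Emono; exact: subS.
  by exists B => _ [n _ <-]; exact: EB.
have snd : nondecreasing_seq s by move=> n m /Emono; exact: subS.
have cover (A : {fset I}) : exists n, (A `<=` E n)%fset.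
  elim/finSet_rect: A => A IH.
  have [->|[a aA]] := fset_0Vmem A; first by exists 0%N; exact: fsub0set.
  have [n An] := IH _ (fproperD1 aA).
  have [m am] := Ecov a; exists (maxn n m); apply/fsubsetP => x xA.
  have [->|xa] := eqVneq x a; first exact: (fsubsetP (Emono _ _ (leq_maxr n m))).
  apply: (fsubsetP (Emono _ _ (leq_maxl n m))); apply: (fsubsetP An).
  by rewrite !inE xa.
apply/cvgrPdist_lt => e e0.
have re0 : 0 < complex.Re e / 2.
  by move: e0; rewrite ltcE /= => /andP[_ ?]; rewrite divr_gt0.
have /cvg_modulusP/(_ _ re0)[N1 h1] := El.
have /cvgrPdist_lt/(_ _ re0)[N2 _ h2] := sc.
pose N := maxn N1 N2; exists (E N) => // A /= EA.
rewrite ltc_modulus// modulus_distC /summability.partial_sum.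
rewrite -(big_seq_fsetE _ _ predT f)/=.
have -> : \sum_(i <- A) f i - l =
    \sum_(i <- [fset x in A | x \notin E N]%fset) f i + (\sum_(i <- E N) f i - l).
  rewrite (big_fsetID _ (mem (E N)) A)/=.
  have -> : [fset x in A | x \in E N]%fset = E N.
    by apply/fsetP => x; rewrite !inE/= andb_idl// => /(fsubsetP EA).
  by rewrite addrA [X in X - _]addrC.
apply: le_lt_trans (modulusD _ _) _; rewrite [complex.Re e]splitr.
apply: ltrD; last by apply: h1; exact: leq_maxl.
apply: le_lt_trans (modulus_sum _ _ _) _.
have [n An] := cover A.
have := h2 N (leq_maxr _ _); rewrite /= => /ltr_normlW; apply: le_lt_trans.
rewrite lerBrDr; apply: le_trans (nondecreasing_cvgn_le snd sc n).
apply: le_trans (subS _ _ An); rewrite [leRHS](big_fsetID _ (mem (E N)) A)/=.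
have -> : [fset x in A | x \in E N]%fset = E N.
  by apply/fsetP => x; rewrite !inE/= andb_idl// => /(fsubsetP EA).
by rewrite addrC.
Qed.
End Exhaustion.

(** The increasing sequences of [d] positive integers with last term [M]
    (with [M = 0] when [d = 0]). *)
Fixpoint paths_to (d M : nat) : seq (seq nat) :=
  if d is d'.+1 then [seq rcons s M | i <- iota 0 M, s <- paths_to d' i]
  else if M == 0%N then [:: [::]] else [::].

Lemma mem_paths_to d M s : (s \in paths_to d M) =
  [&& size s == d, path ltn 0%N s & last 0%N s == M].
Proof.
elim: d M s => [|d IH] M s /=.
  have [->|M0] := eqVneq M 0%N; case: s => [|a s] //=.
  by rewrite eq_sym (negPf M0).
apply/allpairsPdep/idP => [[i [t [iM]]]|].
  rewrite IH => /and3P[/eqP st pt /eqP lt] ->.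
  rewrite mem_iota /= add0n in iM.
  by rewrite size_rcons st eqxx rcons_path pt lt /= iM last_rcons eqxx.
case/lastP: s => [|s m] /and3P[]; first by [].
rewrite size_rcons eqSS rcons_path last_rcons => sd /andP[ps sm] /eqP mM.
rewrite /= in sm; by exists (last 0%N s), s; rewrite mem_iota /= add0n -mM sm IH sd ps eqxx.
Qed.

Lemma uniq_paths_to d M : uniq (paths_to d M).
Proof.
elim: d M => [|d IH] M /=; first by case: ifP.
apply: allpairs_uniq_dep; [exact: iota_uniq|by move=> i _; exact: IH|].
move=> _ _ /allpairsPdep[i [s [_ + ->]]] /allpairsPdep[j [t [_ + ->]]] /=.
rewrite !mem_paths_to => /and3P[_ _ /eqP <-] /and3P[_ _ /eqP <-].
by move=> /rcons_inj[->].
Qed.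

Section SumPaths.
Variables (K : comNzRingType) (x : nat -> K).

(** The monomial of the word [k] at the sequence [m] of indices. *)
Definition path_term (k m : seq nat) : K :=
  \prod_(j < size k) x (nth 0%N m j) ^+ nth 0%N k j.

Lemma sum_path_term k M :
  \sum_(s <- paths_to (size k) M) path_term k s = alpha x k M.
Proof.
elim/last_ind: k M => [|k a IH] M.
  rewrite /= alpha_nil; case: eqP => _; last by rewrite big_nil.
  by rewrite big_seq1 /path_term big_ord0.
rewrite size_rcons alpha_rcons /= big_allpairs_dep /= mulr_sumr.
rewrite -(big_mkord predT (fun i => x M ^+ a * alpha x k i)) /index_iota subn0.
apply: eq_bigr => i _; rewrite -IH mulr_sumr big_seq [RHS]big_seq.
apply: eq_bigr => s; rewrite mem_paths_to => /and3P[/eqP ss _ _].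
rewrite /path_term size_rcons big_ord_recr /= !nth_rcons ss ltnn eqxx mulrC.
congr (_ * _); apply: eq_bigr => j _; rewrite !nth_rcons ss ltn_ord.
by [].
Qed.
End SumPaths.

(** The increasing sequences of [d] positive integers with last term below [n]. *)
Definition paths_below (d n : nat) : seq (seq nat) :=
  flatten [seq paths_to d M | M <- iota 0 n].

Lemma mem_paths_below d n s : (s \in paths_below d n) =
  [&& size s == d, path ltn 0%N s & (last 0%N s < n)%N].
Proof.
apply/flatten_mapP/idP => [[M]|/and3P[sd ps sn]].
  by rewrite mem_iota /= add0n mem_paths_to => Mn /and3P[-> -> /eqP ->].
by exists (last 0%N s); rewrite ?mem_iota// mem_paths_to sd ps eqxx.
Qed.

Lemma uniq_paths_below d n : uniq (paths_below d n).
Proof.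
have -> : paths_below d n = [seq s | M <- iota 0 n, s <- paths_to d M].
  by rewrite /paths_below; congr flatten; apply: eq_map => M; rewrite map_id.
apply: allpairs_uniq_dep; [exact: iota_uniq|by move=> i _; exact: uniq_paths_to|].
move=> _ _ /allpairsPdep[i [s [_ + ->]]] /allpairsPdep[j [t [_ + ->]]] /=.
by rewrite !mem_paths_to => /and3P[_ _ /eqP <-] /and3P[_ _ /eqP <-] ->.
Qed.

Section IndexSet.
Variable d : nat.
Local Notation T := {m : d.-tuple nat | path ltn 0%N m}.

(** A sequence seen as an index of the sums, if it is one. *)
Definition index_of_seq (s : seq nat) : option T :=
  obind insub (insub s : option (d.-tuple nat)).

Lemma index_of_seqK (i : T) : index_of_seq (val i) = Some i.
Proof. by rewrite /index_of_seq (valK (val i)) /= valK. Qed.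

(** The finite sets of indices exhausting the type of all indices. *)
Definition index_below (n : nat) : {fset T} :=
  [fset i in pmap index_of_seq (paths_below d n)]%fset.

Lemma mem_index_below n (i : T) :
  (i \in index_below n) = (last 0%N (val i) < n)%N.
Proof.
rewrite !inE /= mem_pmap; apply/mapP/idP => [[s]|li].
  rewrite mem_paths_below => /and3P[sd ps ls].
  rewrite /index_of_seq; case: insubP => [u _ us|]//=.
  by case: insubP => [v _ vu|]//= [->]; rewrite vu us.
exists (val (val i)); last by rewrite index_of_seqK.
by rewrite mem_paths_below size_tuple eqxx (valP i).
Qed.

Lemma sum_index_below (K : nmodType) (F : seq nat -> K) n :
  \sum_(i <- index_below n) F (val i) =
  \sum_(M < n) \sum_(s <- paths_to d M) F s.
Proof.
transitivity (\sum_(s <- paths_below d n) F s).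
  rewrite -(big_map (fun i : T => val (val i)) predT F).
  apply: perm_big; apply: uniq_perm.
  - by rewrite map_inj_uniq ?fset_uniq// => i j /val_inj/val_inj.
  - exact: uniq_paths_below.
  move=> s; apply/mapP/idP => [[i iE ->]|].
    rewrite mem_index_below in iE.
    by rewrite mem_paths_below size_tuple eqxx (valP i).
  rewrite mem_paths_below => /and3P[sd ps ls].
  by exists (Sub (Tuple sd) ps : T); rewrite ?mem_index_below// SubK.
rewrite /paths_below big_flatten big_map.
by rewrite -(big_mkord predT (fun M => \sum_(s <- paths_to d M) F s)) /index_iota subn0.
Qed.
End IndexSet.

(** * Meromorphic continuation *)

Section Continuation.
Variables (R : realType) (q : R[i]^o).
Local Notation C := (R[i]^o).
Hypotheses (hq0 : 0 < `|q|) (hq1 : `|q| < 1).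
Local Notation r := (modulus q).

Lemma modq_gt0 : 0 < r.
Proof. by rewrite -ltcR -modulusE. Qed.

Lemma modq_lt1 : r < 1.
Proof. by rewrite -ltcR -modulusE. Qed.

Let r0 := modq_gt0.
Let r1 := modq_lt1.

Lemma q_neq0 : q != 0.
Proof. by rewrite -modulus_gt0. Qed.

(** The variable attached to the index [m]; it vanishes at [m = 0]. *)
Definition szvar (m : nat) : C := q ^+ m / (1 - q ^+ m).

Lemma szvar0 : szvar 0 = 0.
Proof. by rewrite /szvar subrr invr0 mulr0. Qed.

Lemma one_sub_qn m : 1 - r <= modulus (1 - q ^+ m.+1).
Proof.
have h : r ^+ m.+1 <= r by rewrite exprS ler_piMr ?(ltW r0)// exprn_ile1// ltW.
have : modulus 1 <= modulus (1 - q ^+ m.+1) + modulus (q ^+ m.+1).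
  by rewrite -{1}(subrK (q ^+ m.+1) 1) modulusD.
by rewrite modulus1 modulusX; lra.
Qed.

Lemma one_sub_qn_neq0 m : 1 - q ^+ m.+1 != 0.
Proof. by rewrite -modulus_gt0 (lt_le_trans _ (one_sub_qn m))// subr_gt0. Qed.

Lemma szvar_bound m : 0 <= modulus (szvar m) <= (1 - r)^-1 * r ^+ m.
Proof.
rewrite modulus_ge0/=; have k0 : 0 < 1 - r by rewrite subr_gt0.
case: m => [|m].
  by rewrite szvar0 modulus0 mulr1 invr_ge0 ltW.
rewrite /szvar modulusM modulusX modulusV mulrC ler_wpM2r ?exprn_ge0 ?(ltW r0)//.
by rewrite lef_pV2 ?one_sub_qn// posrE// (lt_le_trans k0 (one_sub_qn m)).
Qed.

Local Notation coef := (alpha szvar).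

Lemma abs_coef_bound w t : 0 < t -> t * r ^+ last 0%N w < 1 \/ w = [::] ->
  exists M, forall m, alpha (fun i => modulus (szvar i)) w m * t ^+ m <= M.
Proof.
by move=> t0 tw; apply: alpha_bound szvar_bound t0 tw; rewrite r0 r1.
Qed.

Lemma coef_bound w t : 0 < t -> t * r ^+ last 0%N w < 1 \/ w = [::] ->
  bounded_coef (coef w) t.
Proof.
move=> t0 /(abs_coef_bound t0)[M aM]; exists M => m; apply: le_trans (aM m).
by rewrite ler_wpM2r ?modulus_alpha// exprn_ge0// ltW.
Qed.

(** The midpoint of [modulus z] and [r ^ (- n)]. *)
Lemma between (z : C) n : modulus z * r ^+ n < 1 ->
  exists t, [/\ 0 < t, modulus z < t & t * r ^+ n < 1].
Proof.
move=> zn; have rn : 0 < r ^+ n by rewrite exprn_gt0.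
exists ((modulus z + (r ^+ n)^-1) / 2); have z0 := modulus_ge0 z.
have zr : modulus z < (r ^+ n)^-1 by rewrite -[ltRHS]mul1r ltr_pdivlMr.
have rn' : 0 < (r ^+ n)^-1 by rewrite invr_gt0.
split; [lra|lra|].
by rewrite -ltr_pdivlMr// mul1r; lra.
Qed.

Lemma radius_exists w (z : C) : modulus z * r ^+ last 0%N w < 1 \/ w = [::] ->
  exists t, [/\ 0 < t, modulus z < t & t * r ^+ last 0%N w < 1 \/ w = [::]].
Proof.
case=> [/between[t [t0 zt tw]]|->]; first by exists t; split=> //; left.
exists (modulus z + 1); split; [|by rewrite ltrDl|by right].
by rewrite ltr_wpDl// modulus_ge0.
Qed.

Lemma coef_pseries w (z : C) : modulus z * r ^+ last 0%N w < 1 \/ w = [::] ->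
  pseries (coef w) z @ \oo --> psum (coef w) z.
Proof.
move=> zw; have [t [t0 zt tw]] := radius_exists zw.
by have [_ _] := psumP t0 (coef_bound t0 tw); apply.
Qed.

(** The unconditional sum over all index tuples is an ordinary power series: group
    the tuples by their last term. *)
Lemma LSZ_series_psum w (z : C) : modulus z * r ^+ last 0%N w < 1 \/ w = [::] ->
  LSZ_series q w z = psum (coef w) z.
Proof.
move=> zw; have [t [t0 zt tw]] := radius_exists zw.
have [M aM] := abs_coef_bound t0 tw.
pose y i := modulus (szvar i).
have M0 : 0 <= M.
  by apply: le_trans (aM 0%N); rewrite mulr1 alpha_ge0// => i; exact: modulus_ge0.
have mz : 0 <= modulus z / t < 1.
  by rewrite divr_ge0 ?modulus_ge0 ?(ltW t0)//= ltr_pdivrMr// mul1r.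
rewrite /LSZ_series.
apply: (sum_exhaustion (E := index_below (size w)) (B := M / (1 - modulus z / t))).
- move=> n m nm; apply/fsubsetP => i; rewrite !mem_index_below => h.
  exact: leq_trans nm.
- by move=> i; exists (last 0%N (val i)).+1; rewrite mem_index_below.
- move=> n.
  have -> : \sum_(i <- index_below (size w) n)
      modulus (z ^+ last 0%N (val i) * SZ_term q w (val i)) =
    \sum_(m < n) modulus z ^+ m * alpha y w m.
    rewrite (@sum_index_below (size w) _
      (fun s => modulus (z ^+ last 0%N s * SZ_term q w s))).
    apply: eq_bigr => m _; rewrite -sum_path_term mulr_sumr big_seq [RHS]big_seq.
    apply: eq_bigr => s; rewrite mem_paths_to => /and3P[_ _ /eqP ->].
    rewrite modulusM modulusX; congr (_ * _).
    rewrite /path_term /SZ_term; elim/big_rec2: _ => [|i a b _ <-]; first exact: modulus1.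
    by rewrite modulusM modulusX.
  apply: (@le_trans _ _ (\sum_(m < n) M * (modulus z / t) ^+ m)).
    apply: ler_sum => m _; rewrite expr_div_n mulrA [M * _]mulrC -mulrA.
    rewrite ler_wpM2l ?exprn_ge0 ?modulus_ge0// ler_pdivlMr ?exprn_gt0//.
  rewrite -mulr_sumr ler_wpM2l//; have /andP[b0 b1] := mz.
  have b1' : 0 < 1 - modulus z / t by rewrite subr_gt0.
  rewrite -[leRHS]mul1r ler_pdivlMr//.
  have := subrX1 (modulus z / t) n; have := exprn_ge0 n b0.
  by move: (_ ^+ n) (\sum_(i < n) _) => u s; nra.
- have -> : (fun n => \sum_(i <- index_below (size w) n)
      (z ^+ last 0%N (val i) * SZ_term q w (val i))) = pseries (coef w) z.
    apply/funext => n.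
    rewrite (@sum_index_below (size w) _ (fun s => z ^+ last 0%N s * SZ_term q w s)).
    rewrite /pseries /series /= big_mkord; apply: eq_bigr => m _.
    rewrite -sum_path_term mulrC mulr_sumr big_seq [RHS]big_seq.
    by apply: eq_bigr => s; rewrite mem_paths_to => /and3P[_ _ /eqP ->].
  exact: coef_pseries.
Qed.

Lemma ZSZ_word_psum w : last 1%N w != 0%N -> ZSZ_word q w = psum (coef w) 1.
Proof.
move=> wl; rewrite -LSZ_series_psum.
  rewrite /ZSZ_word /LSZ_series; congr summability.sum.
  by apply/funext => m; rewrite expr1n mul1r.
case: w wl => [|a w] wl; [by right|left].
rewrite modulus1 mul1r exprn_ilt1 ?(ltW r0)//.
Qed.

(** Appending [b_0] multiplies the generating series by [z / (1 - z)]. *)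
Lemma psum_rcons0 w (z : C) : modulus z < 1 ->
  psum (coef (rcons w 0%N)) z = z * (1 - z)^-1 * psum (coef w) z.
Proof.
move=> z1.
have wz : modulus z * r ^+ last 0%N w < 1.
  apply: le_lt_trans z1; rewrite ler_piMr ?modulus_ge0//.
  by apply: exprn_ile1; rewrite ltW.
have h0 := coef_pseries (or_introl wz).
have h1 : pseries (coef (rcons w 0)) z @ \oo --> psum (coef (rcons w 0)) z.
  by apply: coef_pseries; left; rewrite last_rcons mulr1.
have z1' : 1 - z != 0.
  by apply: contraTneq z1 => /eqP; rewrite subr_eq0 => /eqP <-; rewrite modulus1 ltxx.
(* The coefficients of [w b_0] at [m + 1] are the sums of those of [w b_0] and [w]
   at [m]. *)
suff : psum (coef (rcons w 0)) z = z * (psum (coef (rcons w 0)) z + psum (coef w) z).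
  move=> h; apply: (mulfI z1'); rewrite -mulrA mulrCA mulVKf// mulrBl mul1r {1}h.
  by ring.
apply: pseries_cvg_psum; rewrite -(cvg_shiftn 1).
rewrite (_ : (fun n => _) =
    fun n => z * (pseries (coef (rcons w 0)) z n + pseries (coef w) z n)).
  exact: cvg_mulCl (cvg_addC h1 h0).
apply/funext => n; rewrite addn1 /pseries.
elim: n => [|n IH].
  by rewrite seriesSr /series /= !big_geq// addr0 add0r mulr1 alpha_rcons0 mulr0.
rewrite [LHS]seriesSr [in LHS]IH !seriesSr.
have -> : coef (rcons w 0) n.+1 = coef (rcons w 0) n + coef w n.
  by rewrite !alpha_rcons !expr0 !mul1r big_ord_recr.
rewrite exprS; ring.
Qed.

(** The first-order [q]-difference equation lowering the last exponent. *)
Lemma psum_rconsS w k (z : C) : modulus z * r ^+ k.+1 < 1 ->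
  psum (coef (rcons w k.+1)) z =
  psum (coef (rcons w k.+1)) (q * z) + psum (coef (rcons w k)) (q * z).
Proof.
move=> zk; have qz : modulus (q * z) * r ^+ k < 1.
  by rewrite modulusM (mulrC r) -mulrA -exprS.
have qz1 : modulus (q * z) * r ^+ k.+1 < 1.
  apply: le_lt_trans qz; rewrite ler_wpM2l ?modulus_ge0// exprS ler_piMl ?(ltW r1)//.
  by rewrite exprn_ge0// ltW.
apply: pseries_cvg_psum.
have h1 : pseries (coef (rcons w k.+1)) (q * z) @ \oo -->
    psum (coef (rcons w k.+1)) (q * z).
  by apply: coef_pseries; left; rewrite last_rcons.
have h2 : pseries (coef (rcons w k)) (q * z) @ \oo --> psum (coef (rcons w k)) (q * z).
  by apply: coef_pseries; left; rewrite last_rcons.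
apply: eq_cvg_series (cvg_seriesD2 h1 h2) => m.
case: m => [|m]; first by rewrite !alpha_rcons0 !mul0r addr0.
have step : (szvar m.+1 + 1) * q ^+ m.+1 = szvar m.+1.
  have d := one_sub_qn_neq0 m; rewrite /szvar -{2}(divff d) -mulrDl subrKC mul1r.
  by rewrite mulrC.
have stepk (X Q Z S : C) : (X + 1) * Q = X ->
    X ^+ k.+1 * S * (Q * Z) + X ^+ k * S * (Q * Z) = X ^+ k.+1 * S * Z.
  move=> XQ; rewrite exprS; transitivity ((X + 1) * Q * X ^+ k * S * Z); first by ring.
  by rewrite XQ.
rewrite !alpha_rcons (exprMn m.+1 q z); exact: stepk step.
Qed.

(** The condition on the disc of convergence, in terms of [modulus]. *)
Lemma ltr_qexpV (z : C) n : (`|z| < `|q| ^- n) = (modulus z * r ^+ n < 1).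
Proof.
rewrite -[RHS]ltr_pdivlMr ?exprn_gt0// div1r -ltcR -modulusE.
by congr (_ < _); rewrite fmorphV rmorphXn /= -modulusE.
Qed.

Lemma LSZ_continuation_nil : LSZ_continuation q [::] (fun=> 1).
Proof.
split.
- by move=> c; apply/mero_at_regular/regular_at_cst.
- by move=> c _; exact: regular_at_cst.
- move=> z _; rewrite LSZ_series_psum; last by right.
  apply/esym/pseries_cvg_psum; apply: (@cvg_eventually_cst _ _ _ 1) => n n1.
  rewrite /pseries (@series_eq0 _ _ 1 n)//; last by case=> // i _; rewrite mul0r.
  by rewrite /series /= big_nat1 mulr1.
Qed.

Lemma LSZ_continuation_rcons0 w F : LSZ_continuation q w F ->
  LSZ_continuation q (rcons w 0%N) (fun z => z * (1 - z)^-1 * F z).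
Proof.
move=> [Fm Fr FE]; split.
- move=> c; apply: mero_atM (Fm c); apply: mero_atM (mero_at_inv c).
  exact/mero_at_regular/regular_at_id.
- move=> c cq; apply: regular_atM (Fr c cq).
  apply: regular_atM (regular_at_id c) (regular_at_inv _).
  by apply/eqP => c1; apply: cq; exists 0%N; rewrite c1 invr1.
- move=> z; rewrite ltr_qexpV last_rcons mulr1 => z1.
  have zw : modulus z * r ^+ last 0%N w < 1.
    apply: le_lt_trans z1; rewrite ler_piMr ?modulus_ge0//.
    by apply: exprn_ile1; rewrite ltW.
  rewrite FE ?ltr_qexpV// LSZ_series_psum; last by left.
  rewrite LSZ_series_psum; last by left; rewrite last_rcons mulr1.
  by rewrite psum_rcons0.
Qed.

Lemma mero_at_sum n (G : nat -> C -> C) c : (forall i, mero_at (G i) c) ->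
  mero_at (fun z => \sum_(i < n) G i z) c.
Proof.
move=> Gm; elim: n => [|n IH].
  rewrite (_ : (fun z => _) = fun=> 0); first exact/mero_at_regular/regular_at_cst.
  by apply/funext => z; rewrite big_ord0.
rewrite (_ : (fun z => _) = fun z => \sum_(i < n) G i z + G n z).
  exact: (mero_atD IH (Gm n)).
by apply/funext => z; rewrite big_ord_recr.
Qed.

Lemma regular_at_sum n (G : nat -> C -> C) c : (forall i, regular_at (G i) c) ->
  regular_at (fun z => \sum_(i < n) G i z) c.
Proof.
move=> Gm; elim: n => [|n IH].
  rewrite (_ : (fun z => _) = fun=> 0); first exact: regular_at_cst.
  by apply/funext => z; rewrite big_ord0.
rewrite (_ : (fun z => _) = fun z => \sum_(i < n) G i z + G n z).
  exact: (regular_atD IH (Gm n)).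
by apply/funext => z; rewrite big_ord_recr.
Qed.

Section RaiseExponent.
Variables (w : seq nat) (k : nat) (F : C -> C).
Hypothesis contF : LSZ_continuation q (rcons w k) F.

(** The [n]-fold iteration of the [q]-difference equation: it is available once
    [q ^ n * z] lies in the disc of convergence. *)
Let iterate n (z : C) : C := psum (coef (rcons w k.+1)) (q ^+ n * z) +
  \sum_(i < n) F (q ^+ i.+1 * z).

(** [q ^ n * z] lies in the disc of convergence of radius [r ^ (- (k + 1))]. *)
Let in_disc (z : C) n := modulus z * r ^+ (n + k.+1) < 1.

Let in_disc_qn z n : in_disc z n -> modulus (q ^+ n * z) * r ^+ k.+1 < 1.
Proof. by rewrite modulusM modulusX mulrAC -exprD mulrC. Qed.

Let in_disc_le z n m : (n <= m)%N -> in_disc z n -> in_disc z m.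
Proof.
move=> nm; apply: le_lt_trans; rewrite ler_wpM2l ?modulus_ge0//.
by apply: ler_wiXn2l; rewrite ?(ltW r0) ?(ltW r1) ?leq_add2r.
Qed.

Let iterateS n z : in_disc z n -> iterate n z = iterate n.+1 z.
Proof.
move=> /in_disc_qn zn; rewrite /iterate big_ord_recr /= psum_rconsS//.
have E : q * (q ^+ n * z) = q ^+ n.+1 * z by rewrite mulrA -exprS.
rewrite !E; have [_ _ FE] := contF; rewrite FE.
  rewrite LSZ_series_psum; last first.
    by left; rewrite last_rcons -E modulusM [r * _]mulrC -mulrA -exprS.
  by rewrite -addrA; congr (_ + _); rewrite addrC.
by rewrite ltr_qexpV last_rcons -E modulusM [r * _]mulrC -mulrA -exprS.
Qed.

Let iterate_eq n m z : in_disc z n -> in_disc z m -> iterate n z = iterate m z.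
Proof.
have le a b : (a <= b)%N -> in_disc z a -> iterate a z = iterate b z.
  move=> ab za; rewrite -(subnKC ab); elim: (b - a)%N => [|j ->].
    by rewrite addn0.
  by rewrite addnS -iterateS//; apply: in_disc_le za; exact: leq_addr.
by move=> zn zm; case: (leqP n m) => [|/ltnW] h; [exact: le|apply/esym; exact: le].
Qed.

Let in_disc_exists z : exists n, in_disc z n.
Proof.
have e0 : 0 < (modulus z + 1)^-1 by rewrite invr_gt0 ltr_wpDl ?modulus_ge0.
have /cvgrPdist_lt/(_ _ e0)[N _ Ne] : (fun n => r ^+ n) @ \oo --> (0 : R).
  by apply: cvg_expr; rewrite gtr0_norm.
exists N; have := Ne (N + k.+1)%N (leq_addr _ _).
rewrite /= distrC subr0 ger0_norm ?exprn_ge0 ?(ltW r0)// => h.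
rewrite /in_disc; apply: le_lt_trans (_ : (modulus z + 1) * r ^+ (N + k.+1) < 1).
  by rewrite ler_wpM2r ?exprn_ge0 ?(ltW r0)// lerDl.
by rewrite -ltr_pdivlMl ?mulr1// ltr_wpDl ?modulus_ge0.
Qed.

(** The continuation of [w b_(k + 1)]: iterate far enough at each point. *)
Let raised (z : C) : C := iterate (xget 0%N [set n | in_disc z n]) z.

Let raisedE z n : in_disc z n -> raised z = iterate n z.
Proof.
move=> zn; apply: iterate_eq => //.
have [m zm] := in_disc_exists z.
exact: (@xgetPex _ 0%N [set n | in_disc z n] (ex_intro _ m zm)).
Qed.

Let in_disc_near c n : in_disc c n ->
  exists2 e : R, 0 < e & forall h, modulus h < e -> in_disc (c + h) n.
Proof.
move=> cn; have rn : 0 < r ^+ (n + k.+1) by rewrite exprn_gt0.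
have h1 : modulus c < (r ^+ (n + k.+1))^-1 by rewrite -[ltRHS]mul1r ltr_pdivlMr.
exists ((r ^+ (n + k.+1))^-1 - modulus c); first by rewrite subr_gt0.
move=> h hh; rewrite /in_disc -ltr_pdivlMr// mul1r.
by apply: le_lt_trans (modulusD _ _) _; rewrite addrC -ltrBrDr.
Qed.

Let qn0 n : q ^+ n != 0.
Proof. by rewrite expf_neq0// q_neq0. Qed.

Let psum_regular n c : in_disc c n ->
  regular_at (fun z => psum (coef (rcons w k.+1)) (q ^+ n * z)) c.
Proof.
move=> /in_disc_qn/between[t [t0 ct tk]].
apply: regular_at_scale => //; apply: (regular_at_psum t0) ct.
by apply: coef_bound => //; left; rewrite last_rcons.
Qed.

Lemma LSZ_continuation_raise : exists F', LSZ_continuation q (rcons w k.+1) F'.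
Proof.
have [Fm Fr FE] := contF; exists raised; split.
- move=> c; have [n cn] := in_disc_exists c; have [e e0 en] := in_disc_near cn.
  apply: (@mero_at_near _ (iterate n) _ _ e) => //.
    by move=> h _ he; rewrite (raisedE (en h he)).
  apply: mero_atD; first exact/mero_at_regular/psum_regular.
  apply: (@mero_at_sum n (fun i z => F (q ^+ i.+1 * z))) => i.
  by apply: mero_at_scale => //; exact: Fm.
- move=> c cq; have [n cn] := in_disc_exists c; have [e e0 en] := in_disc_near cn.
  apply: (@regular_at_near _ (iterate n) _ _ e) => //.
    by move=> h he; rewrite (raisedE (en h he)).
  apply: regular_atD; first exact: psum_regular.
  apply: (@regular_at_sum n (fun i z => F (q ^+ i.+1 * z))) => i.
  apply: regular_at_scale => //; apply: Fr => -[m cm]; apply: cq.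
  exists (m + i.+1)%N; rewrite exprD invfM -cm mulrAC mulfV// mul1r.
  by [].
- move=> z; rewrite ltr_qexpV last_rcons => zk.
  have z0 : in_disc z 0 by [].
  rewrite (raisedE z0) /iterate big_ord0 addr0 mul1r LSZ_series_psum//.
  by left; rewrite last_rcons.
Qed.

End RaiseExponent.

Lemma LSZ_continuation_exists w : exists F, LSZ_continuation q w F.
Proof.
elim/last_ind: w => [|w k [F wF]]; first by exists (fun=> 1); exact: LSZ_continuation_nil.
elim: k => [|k [G kG]]; last exact: LSZ_continuation_raise kG.
by eexists; exact: LSZ_continuation_rcons0 wF.
Qed.

Lemma LSZ_wordP w : LSZ_continuation q w (LSZ_word q w).
Proof.
case: w => [|a w]; first exact: LSZ_continuation_nil.
rewrite /LSZ_word; apply: xgetPex; exact: LSZ_continuation_exists.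
Qed.

End Continuation.

(** * The residue attached to a word *)

Section Residues.
Variables (R : realType) (q : R[i]^o).
Local Notation C := (R[i]^o).
Hypotheses (hq0 : 0 < `|q|) (hq1 : `|q| < 1).
Local Notation r := (modulus q).
Local Notation coef := (alpha (szvar q)).
Local Notation clin := (@qlinear C (@cact R)).

Lemma has_pseries_left_zero a (s : R) (f : C -> C) : has_pseries a s f ->
    (forall t : R, 0 < t < s -> f (- t%:C%C) = 0) ->
  forall h, modulus h < s -> f h = 0.
Proof.
move=> aS f0 h hs; have a0 := has_pseries_left_eq0 aS f0.
have [_ _ af] := aS; rewrite -(pseries_cvg_psum (af h hs)).
apply: pseries_cvg_psum; apply: (@cvg_eventually_cst _ _ _ 0) => n _.
by rewrite /pseries /series /= big1// => i _; rewrite a0 mul0r.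
Qed.

(** Two functions meromorphic at a point that agree on its left agree around it. *)
Lemma mero_at_left_eq (f g : C -> C) (c : C) (e : R) : mero_at f c -> mero_at g c ->
    0 < e -> (forall t : R, 0 < t < e -> f (c - t%:C%C) = g (c - t%:C%C)) ->
  exists2 d : R, 0 < d & forall h, h != 0 -> modulus h < d -> f (c + h) = g (c + h).
Proof.
move=> fm [N [b bL]] e0 fg.
have [M [a /laurent_atP[s [k [aS kfg]]]]] : mero_at (fun z => f z + (-1) * g z) c.
  by apply: mero_atD fm _; exists N, (fun n => (-1) * b n); exact: laurent_atZ.
have s0 : 0 < s by case: aS.
have d0 : 0 < Num.min e s by rewrite lt_min e0 s0.
have aS' : has_pseries a (Num.min e s) k.
  by apply: has_pseriesW aS; rewrite d0 ge_min lexx orbT.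
exists (Num.min e s) => // h h0 hd.
have kz : forall h, modulus h < Num.min e s -> k h = 0.
  apply: (has_pseries_left_zero aS') => t /andP[t0]; rewrite lt_min => /andP[te ts].
  have tn : (- t%:C%C : C) != 0.
    by rewrite oppr_eq0; apply/eqP => /complexI /eqP; rewrite gt_eqF.
  rewrite kfg ?modulusN ?modulus_real ?gtr0_norm//.
  by rewrite fg ?t0// mulN1r subrr mulr0.
have := kz h hd; rewrite kfg//; last by move: hd; rewrite lt_min => /andP[].
move=> /eqP; rewrite mulf_eq0 expf_eq0 (negPf h0) andbF/= mulN1r subr_eq0.
by move/eqP.
Qed.

Lemma coef_radius v : last 1%N v != 0%N ->
  exists2 t : R, 1 < t & bounded_coef (coef v) t.
Proof.
have r0 := modq_gt0 hq0; have r1 := modq_lt1 hq1.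
case/lastP: v => [|v a]; first by exists 2; [lra|apply: coef_bound => //; right].
rewrite last_rcons => a0.
have [|t [t0 t1 ta]] := @between R q hq0 1 a.
  by rewrite modulus1 mul1r exprn_ilt1 ?(ltW r0).
exists t; first by rewrite -modulus1.
by apply: coef_bound => //; left; rewrite last_rcons.
Qed.

Lemma psum_nseq0 v p (z : C) : modulus z < 1 ->
  psum (coef (v ++ nseq p 0%N)) z = (z * (1 - z)^-1) ^+ p * psum (coef v) z.
Proof.
move=> z1; elim: p => [|p IH]; first by rewrite cats0 mul1r.
rewrite -[p.+1]addn1 nseqD catA /= cats1 psum_rcons0// IH addn1 exprS.
by rewrite !mulrA.
Qed.

Lemma LSZ_word_unit_disc w (z : C) : modulus z < 1 ->
  LSZ_word q w z = psum (coef w) z.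
Proof.
move=> z1; have [_ _ FE] := LSZ_wordP hq0 hq1 w.
have r0 := modq_gt0 hq0; have r1 := modq_lt1 hq1.
have zw : modulus z * r ^+ last 0%N w < 1.
  apply: le_lt_trans z1; rewrite ler_piMr ?modulus_ge0//.
  by apply: exprn_ile1; rewrite ltW.
by rewrite FE ?ltr_qexpV// LSZ_series_psum//; left.
Qed.

(** Near [1] the continuation is [(z / (1 - z)) ^ p] times a function regular at
    [1]; the equality is known inside the unit disc and extends by
    [mero_at_left_eq]. *)
Lemma LSZ_word_near1 v p : last 1%N v != 0%N ->
  exists2 d : R, 0 < d & forall h, h != 0 -> modulus h < d ->
    h ^+ p * LSZ_word q (v ++ nseq p 0%N) (1 + h) =
    (-1) ^+ p * ((1 + h) ^+ p * psum (coef v) (1 + h)).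
Proof.
move=> vl; have [t t1 vt] := coef_radius vl; have t0 : 0 < t by lra.
pose f z := (z - 1) ^+ p * LSZ_word q (v ++ nseq p 0%N) z.
pose g z := (-1) ^+ p * (z ^+ p * psum (coef v) z).
have regX (k : C -> C) c : regular_at k c -> regular_at (fun z => k z ^+ p) c.
  move=> kr; elim: p {f g} => [|n IH].
    by rewrite (_ : (fun z => _) = fun=> 1); [exact: regular_at_cst|apply/funext => z].
  rewrite (_ : (fun z => _) = fun z => k z * k z ^+ n); first exact: (regular_atM kr IH).
  by apply/funext => z; rewrite exprS.
have fm : mero_at f 1.
  apply: mero_atM; last by have [Fm _ _] := LSZ_wordP hq0 hq1 (v ++ nseq p 0%N); exact: Fm.
  apply/mero_at_regular/(regX (fun z => z - 1)).
  exact: (regular_atD (regular_at_id 1) (regular_at_cst (-1) 1)).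
have gm : mero_at g 1.
  apply/mero_at_regular/(regular_atM (regular_at_cst _ _)).
  apply: (regular_atM (regX id 1 (regular_at_id 1))).
  by apply: (regular_at_psum t0 vt); rewrite modulus1.
have [|d d0 fg] := mero_at_left_eq fm gm (@ltr01 R).
  move=> s /andP[s0 s1]; have z1 : modulus (1 - s%:C%C : C) < 1.
    have -> : (1 - s%:C%C : C) = (1 - s)%:C%C by rewrite rmorphB rmorph1.
    by rewrite modulus_real gtr0_norm; lra.
  move: (1 - s%:C%C : C) z1 => z z1.
  rewrite /f /g (LSZ_word_unit_disc (v ++ nseq p 0%N) z1) (psum_nseq0 v p z1).
  rewrite !mulrA -!exprMn.
  have z1' : 1 - z != 0.
    by apply: contraTneq z1 => /eqP; rewrite subr_eq0 => /eqP <-; rewrite modulus1 ltxx.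
  congr (_ ^+ p * _); rewrite mulN1r -[z - 1]opprB mulNr mulrCA mulfV// mulr1.
  by [].
exists d => // h h0 hd; have := fg h h0 hd; rewrite /f /g.
have -> : 1 + h - 1 = h by rewrite addrC addKr.
by [].
Qed.

(** The term of index [m] in the value of the residue for [v b_0 ^ p], up to the
    sign [(-1) ^ p]. The predecessor is only truncated for [m = p = 0], where the
    binomial coefficient is [1] as it should be. *)
Definition residue_term (a : nat -> C) p m : C := a m * 'C((m + p).-1, p)%:R.

(** The residue at [1] in the statement, for a single word. *)
Definition word_residue w : C :=
  residue (fun z : C => LSZ_word q w z / (z * (z - 1))) 1.

Lemma cvg_series_shift (u : nat -> C) (l : C) k :
    (forall i, (i < k)%N -> u i = 0) ->
  series u @ \oo --> l <-> series (fun n => u (n + k)%N) @ \oo --> l.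
Proof.
move=> u0; have E : series (fun n => u (n + k)%N) = fun n => series u (n + k)%N.
  apply/funext => n; elim: n => [|n IH].
    rewrite add0n /series /= big_geq// big_nat big1//.
  by rewrite addSn !seriesSr IH.
by rewrite E; split=> h; [rewrite (cvg_shiftn k)|rewrite -(cvg_shiftn k)].
Qed.

Lemma residue_word_nil :
  has_residue (fun z : C => LSZ_word q [::] z / (z * (z - 1))) 1 1.
Proof.
have N1 : (-1 : C) != 0 by rewrite oppr_eq0 oner_eq0.
have S := has_pseriesZ (-1) (has_pseries_inv N1).
have E : -1 * ((-1)^-1 * (-1)^-1 ^+ 0) = 1 :> C by rewrite mulr1 mulfV.
rewrite -[X in has_residue _ _ X]E.
apply: has_residue_pseries S _ => h h0 h1 /=.
have h1' : 1 + h != 0.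
  apply: contraTneq h1 => /eqP; rewrite addrC addr_eq0 => /eqP ->.
  by rewrite ltxx.
have -> : 1 + h - 1 = h by rewrite addrC addKr.
rewrite expr1 mul1r invfM mulrCA mulfV// mulr1 mulN1r -invrN opprB.
by rewrite opprK addrC.
Qed.

(** The residue of a word [v b_0 ^ p] as a convergent series. *)
Lemma residue_word v p : last 1%N v != 0%N -> exists l : C,
  has_residue (fun z : C => LSZ_word q (v ++ nseq p 0%N) z / (z * (z - 1))) 1
    ((-1) ^+ p * l) /\
  series (residue_term (coef v) p) @ \oo --> l.
Proof.
move=> vl; have [[-> ->]|vp] : (v = [::] /\ p = 0%N) \/ (v <> [::] \/ p <> 0%N).
  by case: v {vl} => [|a v]; case: p => [|p]; [left|right; right|right; left|right; left].
  exists 1; split; first by rewrite mul1r; exact: residue_word_nil.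
  apply: (@cvg_eventually_cst _ _ _ 1) => n n1.
  rewrite (@series_eq0 _ _ 1 n)//; last by case=> // i _; rewrite /residue_term mul0r.
  by rewrite /series /= big_nat1 /residue_term mul1r.
have [t t1 vt] := coef_radius vl; have t0 : 0 < t by lra.
(* [s] holds the coefficients of [z ^ p * L(v)(z)]. Outside the case just treated
   its constant term vanishes, and [b] holds those of [z ^ (p - 1) * L(v)(z)]. *)
pose s := shift_coef p (coef v).
have s0 : s 0%N = 0.
  rewrite /s /shift_coef; case: ltnP => //; rewrite leqn0 => /eqP p0.
  case: vp => [|/(_ p0)//]; rewrite sub0n.
  by case/lastP: (v) => [/(_ erefl)//|v' a _]; rewrite alpha_rcons0.
have sS : has_pseries s t (fun z => z ^+ p * psum (coef v) z).
  exact: has_pseries_shift (psumP t0 vt).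
pose b n := s n.+1.
have bt : bounded_coef b t.
  have [_ [M sM] _] := sS; exists (M / t) => n.
  by rewrite ler_pdivlMr// -mulrA -exprSr; exact: sM.
have bE (z : C) : modulus z < t -> z * psum b z = z ^+ p * psum (coef v) z.
  move=> zt; have [_ _ /(_ _ zt) h1] := psumP t0 bt.
  have [_ _ /(_ _ zt) h2] := sS.
  rewrite -(pseries_cvg_psum h2); apply/esym/pseries_cvg_psum.
  rewrite -(cvg_shiftn 1).
  rewrite (_ : (fun n => _) = fun n => z * pseries b z n); first exact: cvg_mulCl h1.
  apply/funext => n; rewrite addn1 /pseries; elim: n => [|n IH].
    by rewrite seriesSr /series /= !big_geq// s0 mul0r mulr0 addr0.
  rewrite [LHS]seriesSr [in LHS]IH seriesSr mulrDr; congr (_ + _).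
  by rewrite exprS mulrCA.
have S1 : has_pseries (recenter b 1) ((t - modulus 1) / 2) (fun h => psum b (1 + h)).
  by apply: has_pseries_recenter (psumP t0 bt) _; rewrite modulus1.
have [d d0 dE] := LSZ_word_near1 p vl.
exists (recenter b 1 p); split.
  have S2 := has_pseriesZ ((-1) ^+ p) S1.
  have e0 : 0 < Num.min d ((t - 1) / 2) by rewrite lt_min d0 /=; lra.
  have S3 : has_pseries (fun n => (-1) ^+ p * recenter b 1 n)
      (Num.min (Num.min d ((t - 1) / 2)) 1) (fun h => (-1) ^+ p * psum b (1 + h)).
    apply: has_pseriesW S2; rewrite lt_min e0 ltr01 /= modulus1.
    by rewrite ge_min ge_min lexx !orbT.
  apply: (has_residue_pseries S3) => h h0; rewrite !lt_min => /andP[/andP[hd ht] h1].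
  have h1' : 1 + h != 0.
    apply: contraTneq h1 => /eqP; rewrite addrC addr_eq0 => /eqP ->.
    by rewrite modulusN modulus1 ltxx.
  have -> : 1 + h - 1 = h by rewrite addrC addKr.
  have tE : modulus (1 + h) < t.
    by apply: le_lt_trans (modulusD _ _) _; rewrite modulus1; lra.
  apply: (mulfI h1').
  transitivity (h ^+ p * LSZ_word q (v ++ nseq p 0%N) (1 + h)).
    rewrite exprSr; set L := LSZ_word _ _ _.
    rewrite invfM; transitivity (h ^+ p * L * ((1 + h) / (1 + h)) * (h / h)); first by ring.
    by rewrite !divff// !mulr1.
  by rewrite dE// -bE// mulrCA.
have rc := @recenter_cvg _ b t 1 p t0 bt; rewrite modulus1 in rc.
have {rc} := rc t1.
pose u m := s m * 'C(m.-1, p)%:R : C.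
have uE : series (fun j => b j * ('C(j, p)%:R * 1 ^+ (j - p))) =
    series (fun n => u (n + 1)%N).
  by congr series; apply/funext => j; rewrite expr1n mulr1 addn1.
rewrite uE -cvg_series_shift; last by case=> // _; rewrite /u s0 mul0r.
rewrite (@cvg_series_shift u _ p); last first.
  by move=> i ip; rewrite /u /s /shift_coef ip mul0r.
apply: eq_cvg_series => m.
by rewrite /u /residue_term /s /shift_coef ltnNge leq_addl /= addnK.
Qed.
End Residues.

(** * The residue as a linear functional *)

Section ResidueFunctional.
Variables (R : realType) (q : R[i]^o).
Local Notation C := (R[i]^o).
Hypotheses (hq0 : 0 < `|q|) (hq1 : `|q| < 1).
Local Notation coef := (alpha (szvar q)).
Local Notation coefQ := (alphaQ (szvar q)).
Local Notation clin := (@qlinear C (@cact R)).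

Lemma word_residueP v p : last 1%N v != 0%N ->
  series (residue_term (coef v) p) @ \oo -->
    (-1) ^+ p * word_residue q (v ++ nseq p 0%N).
Proof.
move=> vl; have [l [fl sl]] := residue_word hq0 hq1 p vl.
by rewrite /word_residue (has_residueE fl) mulrA -exprMn mulrNN mulr1 expr1n mul1r.
Qed.

Lemma word_has_residue w :
  has_residue (fun z : C => LSZ_word q w z / (z * (z - 1))) 1 (word_residue q w).
Proof.
have [v [p [-> vl]]] := word_split w.
have [l [fl _]] := residue_word hq0 hq1 p vl.
by rewrite /word_residue (has_residueE fl).
Qed.

(** The linear extension of [word_residue]. *)
Definition residueQ (u : QB) : C := cext (word_residue q) u.

Lemma residueQ_lin : clin residueQ.
Proof. exact: cext_lin. Qed.

Lemma residueQD u v : residueQ (u + v) = residueQ u + residueQ v.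
Proof. exact: (qlinearD (@cact1 R) residueQ_lin). Qed.

Lemma residueQ0 : residueQ 0 = 0.
Proof. exact: (qlinear0 (@cact1 R) residueQ_lin). Qed.

Lemma residueQMn u n : residueQ (u *+ n) = residueQ u *+ n.
Proof.
elim: n => [|n IH]; first by rewrite !mulr0n residueQ0.
by rewrite !mulrS residueQD IH.
Qed.

Lemma residueQ_word w : residueQ (word w) = word_residue q w.
Proof. exact: cext_word. Qed.

Lemma residue_LSZ u :
  residue (fun z : C => LSZ q u z / (z * (z - 1))) 1 = residueQ u.
Proof.
apply: has_residueE; rewrite /residueQ /cext /lext /cact.
rewrite (_ : (fun z => _) = fun z => \sum_(w <- msupp u)
    ratr (mcoeff w u) * (LSZ_word q w z / (z * (z - 1)))); last first.
  by apply/funext => z; rewrite /LSZ mulr_suml; apply: eq_bigr => w _; rewrite mulrA.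
apply: (@has_residue_sum _ _ _ (fun w z =>
    ratr (mcoeff w u) * (LSZ_word q w z / (z * (z - 1))))) => w.
exact: has_residueZ (word_has_residue w).
Qed.

Lemma word_pow v p : word (v ++ nseq p 0%N) = word v * letter 0 ^+ p.
Proof. by rewrite word_cat word_nseq0. Qed.

(** The series computing the residue, for a combination of words with a common
    last letter [b_a], [a > 0], followed by [b_0 ^ p]. *)
Lemma residueQ_rconsP X a p : a != 0%N ->
  series (residue_term (coefQ (X * letter a)) p) @ \oo -->
    (-1) ^+ p * residueQ (X * letter a * letter 0 ^+ p).
Proof.
move=> a0; move: X; apply: QB_ind => [|c w x IH].
  rewrite !mul0r residueQ0 mulr0; apply: (@cvg_eventually_cst _ _ _ 0) => n _.
  rewrite /series /= big1// => i _; rewrite /residue_term.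
  by rewrite (qlinear0 (@cact1 R) (alphaQ_lin _ i)) mul0r.
have h : series (residue_term (coefQ (word w * letter a)) p) @ \oo -->
    (-1) ^+ p * residueQ (word w * letter a * letter 0 ^+ p).
  rewrite -word_rcons -word_pow residueQ_word.
  have wl : last 1%N (rcons w a) != 0%N by rewrite last_rcons.
  have hw := @word_residueP (rcons w a) p wl.
  have E m : residue_term (coef (rcons w a)) p m =
      residue_term (coefQ (word (rcons w a))) p m.
    by rewrite /residue_term alphaQ_word.
  exact: (eq_cvg_series E hw).
have l1 : clin (fun X => residueQ (X * letter a * letter 0 ^+ p)).
  exact: (qlin_comp residueQ_lin
    (qlin_mulr (letter 0 ^+ p) (qlin_mulr (letter a) qlin_id))).
have l2 m : clin (fun X => coefQ (X * letter a) m).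
  exact: (qlin_comp (alphaQ_lin _ m) (qlin_mulr (letter a) qlin_id)).
have hs := cvg_seriesD2 (cvg_seriesMl (ratr c) h) IH.
have linS (X A B k s : C) : X = k * A + B -> k * (s * A) + s * B = s * X.
  by move=> ->; ring.
rewrite (linS _ _ _ _ ((-1) ^+ p) (l1 c (word w) x)) in hs.
have linT (X A B k s : C) : X = k * A + B -> k * (A * s) + B * s = X * s.
  by move=> ->; ring.
exact: (eq_cvg_series (fun m => linT _ _ _ _ _ (l2 m c (word w) x)) hs).
Qed.

Lemma word_residue_nseq0 p : word_residue q (nseq p 0%N) = (p == 0%N)%:R.
Proof.
have h := @word_residueP [::] p isT.
have h0 : series (residue_term (coef [::]) p) @ \oo --> ((p == 0%N)%:R : C).
  apply: (@cvg_eventually_cst _ _ _ 1) => n n1.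
  rewrite (@series_eq0 _ _ 1 n)//; last by case=> // i _; rewrite /residue_term mul0r.
  rewrite /series /= big_nat1 /residue_term mul1r add0n.
  by case: p {h} => [|p]; rewrite ?bin0// bin_small.
have := cvg_unique (@norm_hausdorff _ _) h h0; rewrite cat0s.
case: p {h h0} => [|p] /=; first by rewrite mul1r => ->.
have N1 : (-1) ^+ p.+1 != 0 :> C by rewrite expf_neq0// oppr_eq0 oner_eq0.
by move=> E; apply: (mulfI N1); rewrite E mulr0.
Qed.

Lemma binomial_step (K : comNzRingType) (m p : nat) (a : K) : (m != 0%N) ->
  (m%:R - 1) * a * 'C((m + p).-1, p)%:R + p.+1%:R *
    (a * 'C((m + p).-1, p)%:R) = p.+1%:R * (a * 'C((m + p.+1).-1, p.+1)%:R).
Proof.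
case: m => [//|m] _.
have : ((m.+1 + p) * 'C((m.+1 + p).-1, p) = p.+1 * 'C(m.+1 + p, p.+1))%N.
  exact: mul_bin_diag.
rewrite addnS /= => /(congr1 (fun n => n%:R : K)); rewrite !natrM => E.
rewrite [RHS]mulrCA -E natrD -[p.+1%:R]natr1; ring.
Qed.

Lemma mul_pow_distr (A : pzRingType) (x y b : A) p :
  (x + y * b + y) * b ^+ p = x * b ^+ p + y * b ^+ p.+1 + y * b ^+ p.
Proof. by rewrite !mulrDl -(mulrA y) -exprS. Qed.

(** The residue annihilates every stuffle multiple of [b_0]. *)
Lemma residueQ_stuffle0 u : residueQ (stuffle0 u) = 0.
Proof.
have l1 : clin (fun u => residueQ (stuffle0 u)).
  exact: (qlin_comp residueQ_lin stuffle0_qlin).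
have l2 : clin (fun _ : QB => 0 : C).
  by move=> c x y; rewrite /cact mulr0 addr0.
apply: (clin_eq l1 l2 _ u) => {u} w.
have [v [p [-> vl]]] := word_split w; rewrite word_pow stuffle0_pow.
rewrite residueQD residueQMn residueQD -!word_pow !residueQ_word.
case/lastP: v vl => [|v a] vl.
  rewrite word_nil stuffle0_1 -exprS -word_nseq0 residueQ_word !cat0s.
  by rewrite !word_residue_nseq0 /= !add0r; case: p => [|p]; rewrite ?mulr0n ?mul0rn.
have a0 : a != 0%N by rewrite last_rcons in vl.
have hp := @word_residueP (rcons v a) p vl.
have hp1 := @word_residueP (rcons v a) p.+1 vl.
have hD := @residueQ_rconsP (stuffle0 (word v)) a p a0.
have -> : stuffle0 (word (rcons v a)) * letter 0 ^+ p =
    stuffle0 (word v) * letter a * letter 0 ^+ p +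
    word (rcons v a ++ nseq p.+1 0%N) + word (rcons v a ++ nseq p 0%N).
  rewrite (word_pow _ p.+1) (word_pow _ p) !word_rcons stuffle0_rcons.
  exact: mul_pow_distr.
rewrite (residueQD (_ + _)) residueQD !residueQ_word.
set X := residueQ _ in hD *; set W := word_residue q (_ ++ nseq p 0) in hp *.
set W1 := word_residue q _ in hp1 *.
have h1 := cvg_seriesD2 hD (cvg_seriesMl (p.+1%:R : C) hp).
have h2 := cvg_seriesMl (p.+1%:R : C) hp1.
have E : (-1) ^+ p * X + p.+1%:R * ((-1) ^+ p * W) = p.+1%:R * ((-1) ^+ p.+1 * W1).
  apply: (cvg_unique (@norm_hausdorff _ _) _ h2).
  suff Em m : residue_term (coefQ (stuffle0 (word v) * letter a)) p m +
      p.+1%:R * residue_term (coef (rcons v a)) p m =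
      p.+1%:R * residue_term (coef (rcons v a)) p.+1 m.
    exact: (eq_cvg_series Em h1).
  rewrite /residue_term alphaQ_stuffle0_rcons -word_rcons alphaQ_word.
  have [->|m0] := eqVneq m 0%N.
    by rewrite alpha_rcons0 !mulr0 !mul0r !mulr0 addr0.
  exact: binomial_step.
have N1 : (-1) ^+ p != 0 :> C by rewrite expf_neq0// oppr_eq0 oner_eq0.
apply: (mulfI N1); rewrite mulr0.
have : (-1) ^+ p * X + p.+1%:R * ((-1) ^+ p * W) - p.+1%:R * ((-1) ^+ p.+1 * W1) = 0.
  by rewrite E subrr.
move=> <-; rewrite exprS -mulr_natl -[p.+1%:R]natr1; ring.
Qed.

Lemma word_residue_admissible w : last 1%N w != 0%N -> word_residue q w = ZSZ_word q w.
Proof.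
move=> wl; rewrite ZSZ_word_psum//; have := @word_residueP w 0 wl.
rewrite mul1r cats0 => h; apply/esym/pseries_cvg_psum.
suff E m : residue_term (coef w) 0 m = coef w m * 1 ^+ m by exact: (eq_cvg_series E h).
by rewrite /residue_term addn0 bin0 expr1n.
Qed.

Lemma residueQ_QB0 u : QB0 u -> residueQ u = ZSZ q u.
Proof.
move=> u0; rewrite /residueQ /cext /lext /ZSZ; apply: eq_big_seq => w wu.
by rewrite word_residue_admissible//; exact: u0.
Qed.

End ResidueFunctional.

Theorem theorem1 (R : realType) (q : R[i]^o)
    (hq0 : 0 < `|q|) (hq1 : `|q| < 1) (u : QB) :
  ZSZ q (reg u) = residue (fun z : R[i]^o => LSZ q u z / (z * (z - 1))) 1.
Proof.
rewrite (residue_LSZ hq0 hq1); have [k [v [uv ->]]] := regP u.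
rewrite (reg_decompositionE uv).
have [v0 _] := uv; rewrite -(residueQ_QB0 hq0 hq1 (v0 0%N isT)).
rewrite (big_morph (residueQ q) (residueQD q) (residueQ0 q)).
rewrite big_ord_recl /= big1 ?addr0// => i _.
exact: residueQ_stuffle0.
Qed.
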